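(* Let $k$ be a positive integer and let $\Lambda$ be a fundamental weight of type $A_k^{(1)}$. For every $w\in W$ and every integer $1\le i\le k$, $$D_\Lambda(\mathbf{h}_i\mathbf{u}_w) = \mathbf{h}_{i-1}\mathbf{u}_w + \mathbf{h}_i D_\Lambda(\mathbf{u}_w).$$ In particular $D_\Lambda(\mathbf{h}_i)=\mathbf{h}_{i-1}$ and $D_\Lambda\circ U_i - U_i\circ D_\Lambda = U_{i-1}$, where $U_m$ denotes the operator $\mathbf{u}\mapsto \mathbf{h}_m\mathbf{u}$ on $\mathbb{A}$.
   Context: $I=\{0,1,\dots,k\}$; $i,j\in I$ are adjacent if $i-j\equiv\pm1\pmod{k+1}$. $W$ is the affine symmetric group generated by $s_i$ ($i\in I$) with $s_i^2=1$, $s_is_j=s_js_i$ for non-adjacent $i,j$, $s_is_js_i=s_js_is_j$ for adjacent $i,j$; $\ell$ is length. Root datum of type $A_k^{(1)}$: simple coroots $\alpha_i^\vee\in\mathfrak{h}$, simple roots $\alpha_i\in\mathfrak{h}^*$, pairing $\langle\cdot,\cdot\rangle$ with $\langle\alpha_i^\vee,\alpha_j\rangle=2,-1,0$ according as $i=j$, $i,j$ adjacent, otherwise; $W$ acts by $s_i(\lambda)=\lambda-\langle\alpha_i^\vee,\lambda\rangle\alpha_i$ and $s_i(\mu)=\mu-\langle\mu,\alpha_i\rangle\alpha_i^\vee$. Fundamental weights $\Lambda_j$: $\langle\alpha_i^\vee,\Lambda_j\rangle=\delta_{ij}$. For a Bruhat cover $v\lessdot w$ ($v<w$ in Bruhat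 order, $\ell(v)=\ell(w)-1$), $v^{-1}w=us_iu^{-1}$ is a reflection, $\alpha_{v,w}=u(\alpha_i)$ is the corresponding positive real root and $\alpha_{v,w}^\vee=u(\alpha_i^\vee)$. The nilCoxeter algebra $\mathbb{A}$ (over $\mathbb{Q}$) has generators $\mathbf{u}_i$ ($i\in I$) with $\mathbf{u}_i^2=0$, $\mathbf{u}_i\mathbf{u}_j=\mathbf{u}_j\mathbf{u}_i$ for non-adjacent $i,j$, $\mathbf{u}_i\mathbf{u}_j\mathbf{u}_i=\mathbf{u}_j\mathbf{u}_i\mathbf{u}_j$ for adjacent $i,j$; $\mathbf{u}_w=\mathbf{u}_{i_1}\cdots\mathbf{u}_{i_m}$ for any reduced word $s_{i_1}\cdots s_{i_m}$ of $w$, and $\{\mathbf{u}_w\}_{w\in W}$ is a basis. The down operator $D_\Lambda:\mathbb{A}\to\mathbb{A}$ is the linear map $D_\Lambda(\mathbf{u}_w)=\sum_{v\lessdot w}\langle\alpha_{v,w}^\vee,\Lambda\rangle\,\mathbf{u}_v$. For a proper subset $S\subsetneq I$, $w_S$ is the unique element of $W$ all of whose reduced words use each letter of $S$ exactly once (and no other letters) and, whenever $j,j+1\in S$ (indices mod $k+1$), have $s_{j+1}$ appearing before $s_j$; $\mathbf{u}_S=\mathbf{u}_{w_S}$. For $0\le i\le k$, $\mathbf{h}_i=\sum_{S\subset I,|S|=i}\mathbf{u}_S$ (so $\mathbf{h}_0=1$).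
   Formalization: For k=1 the stated relations (braid relation, pairing -1 between 0 and 1) would give the symmetric group S_3, where the identity fails; the formal version uses the genuine type A_1^(1): pairing -2 and no braid relation in W or in the nilCoxeter algebra. *)

(* Defs.v *)
From HB Require Import structures.
From mathcomp Require Import all_boot all_order all_algebra.
From mathcomp Require Import finmap.
From mathcomp Require Import boolp classical_sets cardinality fsbigop.
From mathcomp Require Import monalg ring.

Set Implicit Arguments.
Unset Strict Implicit.
Unset Printing Implicit Defensive.

Import GRing.Theory.
Local Open Scope quotient_scope.
Local Open Scope classical_set_scope.
Local Open Scope ring_scope.

(* [ordS i] is i + 1 modulo k + 1. *)
Definition adjacent (k : nat) (i j : 'I_k.+1) : bool :=
  (i == ordS j) || (j == ordS i).

(* In type A_1^(1) the two vertices are joined by a double edge: the Cartan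
   integers are -2 and the product s_0 s_1 has infinite order, so there is no
   braid relation when k = 1. *)
Definition braided (k : nat) (i j : 'I_k.+1) : bool :=
  adjacent i j && (1 < k)%N.

Definition cartan (k : nat) (i j : 'I_k.+1) : rat :=
  if i == j then 2
  else if adjacent i j then (if k == 1%N then - 2 else - 1)
  else 0.

Lemma adjacentC (k : nat) (i j : 'I_k.+1) : adjacent i j = adjacent j i.
Proof. by rewrite /adjacent orbC. Qed.

Lemma cartanC (k : nat) (i j : 'I_k.+1) : cartan i j = cartan j i.
Proof. by rewrite /cartan eq_sym adjacentC. Qed.

Lemma cartan_nadj (k : nat) (i j : 'I_k.+1) :
  ~~ adjacent i j -> i != j -> cartan i j = 0.
Proof. by rewrite /cartan => /negPf -> /negPf ->. Qed.

Lemma cartan_braided (k : nat) (i j : 'I_k.+1) :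
  braided i j -> cartan i j = - 1.
Proof.
case/andP=> ij k1; rewrite /cartan ij gtn_eqF //.
have neS (l : 'I_k.+1) : (l == ordS l) = false.
  apply/negbTE/negP=> /eqP/(congr1 val) /=.
  have [lk|] := ltnP l k.
    by rewrite modn_small // => /eqP; rewrite ltn_eqF.
  move=> kl; have -> : l = k :> nat.
    by apply/eqP; rewrite eqn_leq kl -ltnS ltn_ord.
  by rewrite modnn => k0; rewrite k0 in k1.
by case: eqVneq ij => // ->; rewrite /adjacent neS.
Qed.

Inductive coxeter_rel (k : nat) : seq 'I_k.+1 -> seq 'I_k.+1 -> Prop :=
| CoxSquare i : coxeter_rel [:: i; i] [::]
| CoxComm i j : ~~ adjacent i j -> coxeter_rel [:: i; j] [:: j; i]
| CoxBraid i j : braided i j -> coxeter_rel [:: i; j; i] [:: j; i; j].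

(* The generators being involutions, the group with this presentation is the
   monoid with this presentation: words modulo the generated congruence. *)
Inductive coxeter_cong (k : nat) : seq 'I_k.+1 -> seq 'I_k.+1 -> Prop :=
| CoxStep a l r b : coxeter_rel l r -> coxeter_cong (a ++ l ++ b) (a ++ r ++ b)
| CoxRefl s : coxeter_cong s s
| CoxSym s t : coxeter_cong s t -> coxeter_cong t s
| CoxTrans s t u : coxeter_cong s t -> coxeter_cong t u -> coxeter_cong s u.

Definition coxeter_eq (k : nat) : rel (seq 'I_k.+1) :=
  fun s t => `[< coxeter_cong s t >].

Lemma coxeter_eq_equiv (k : nat) : equiv_class_of (@coxeter_eq k).
Proof.
split=> [s | s t | t s u].
- exact/asboolP/CoxRefl.
- by apply/asboolP/asboolP; apply: CoxSym.
- by move=> /asboolP st /asboolP tu; apply/asboolP/(CoxTrans st tu).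
Qed.

Canonical coxeter_eq_equivRel (k : nat) := EquivRelPack (coxeter_eq_equiv k).

Definition affsym (k : nat) := {eq_quot (@coxeter_eq k)}.

HB.instance Definition _ (k : nat) := Choice.on (affsym k).
HB.instance Definition _ (k : nat) := EqQuotient.on (affsym k).

Definition Wword (k : nat) (s : seq 'I_k.+1) : affsym k := \pi_(affsym k) s.

Lemma WwordP (k : nat) (s t : seq 'I_k.+1) :
  Wword s = Wword t <-> coxeter_cong s t.
Proof.
split; first by move/eqmodP/asboolP.
by move=> st; apply/eqmodP/asboolP.
Qed.

Lemma Wword_repr (k : nat) (w : affsym k) : Wword (repr w) = w.
Proof. exact: reprK. Qed.

Lemma cong_repr (k : nat) (s : seq 'I_k.+1) : coxeter_cong (repr (Wword s)) s.
Proof. by apply/WwordP; rewrite Wword_repr. Qed.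

Lemma cong_cat (k : nat) (s s' t t' : seq 'I_k.+1) :
  coxeter_cong s s' -> coxeter_cong t t' -> coxeter_cong (s ++ t) (s' ++ t').
Proof.
move=> ss' tt'; apply: (@CoxTrans _ _ (s' ++ t)).
  elim: ss' => {s s'} [a l r b lr|s|s u _ IH|s u v _ IH1 _ IH2].
  - by rewrite -!catA; apply: CoxStep.
  - exact: CoxRefl.
  - exact: CoxSym.
  - exact: CoxTrans IH1 IH2.
elim: tt' => {t t'} [a l r b lr|t|t u _ IH|t u v _ IH1 _ IH2].
- by rewrite !(catA s'); apply: CoxStep.
- exact: CoxRefl.
- exact: CoxSym.
- exact: CoxTrans IH1 IH2.
Qed.

Lemma cong_rev (k : nat) (s t : seq 'I_k.+1) :
  coxeter_cong s t -> coxeter_cong (rev s) (rev t).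
Proof.
elim=> {s t} [a l r b lr|t|t u _ IH|t u v _ IH1 _ IH2].
- rewrite !rev_cat -!catA; apply: CoxStep.
  case: lr => [i|i j ij|i j ij].
  + exact: CoxSquare.
  + by apply: CoxComm; rewrite adjacentC.
  + exact: CoxBraid.
- exact: CoxRefl.
- exact: CoxSym.
- exact: CoxTrans IH1 IH2.
Qed.

Lemma cong_revK (k : nat) (s : seq 'I_k.+1) : coxeter_cong (rev s ++ s) [::].
Proof.
elim: s => [|i s IH] /=; first exact: CoxRefl.
rewrite rev_cons -cats1 -catA /=; apply: CoxTrans IH.
exact: (@CoxStep _ (rev s) [:: i; i] [::] s (CoxSquare i)).
Qed.

Definition Wone (k : nat) : affsym k := Wword [::].
Definition Wmul (k : nat) (v w : affsym k) : affsym k :=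
  Wword (repr v ++ repr w).
Definition Winv (k : nat) (w : affsym k) : affsym k := Wword (rev (repr w)).

Lemma WmulE (k : nat) (s t : seq 'I_k.+1) :
  Wmul (Wword s) (Wword t) = Wword (s ++ t).
Proof. by apply/WwordP/cong_cat; apply: cong_repr. Qed.

Lemma WinvE (k : nat) (s : seq 'I_k.+1) : Winv (Wword s) = Wword (rev s).
Proof. exact/WwordP/cong_rev/cong_repr. Qed.

Section AffSymGroup.
Variable k : nat.
Implicit Types u v w : affsym k.

Fact WmulA : associative (@Wmul k).
Proof.
move=> u v w; rewrite -(Wword_repr u) -(Wword_repr v) -(Wword_repr w).
by rewrite !WmulE catA.
Qed.

Fact Wmul1 : left_id (Wone k) (@Wmul k).
Proof. by move=> w; rewrite -(Wword_repr w) WmulE. Qed.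

Fact Wmulr1 : right_id (Wone k) (@Wmul k).
Proof. by move=> w; rewrite -(Wword_repr w) WmulE cats0. Qed.

Fact WmulV : left_inverse (Wone k) (@Winv k) (@Wmul k).
Proof.
by move=> w; rewrite -(Wword_repr w) WinvE WmulE; apply/WwordP/cong_revK.
Qed.

Fact WmulrV : right_inverse (Wone k) (@Winv k) (@Wmul k).
Proof.
move=> w; rewrite -(Wword_repr w) WinvE WmulE; apply/WwordP.
by rewrite -{1}(revK (repr w)); apply: cong_revK.
Qed.

End AffSymGroup.

HB.instance Definition _ (k : nat) :=
  isGroup.Build (affsym k) (@WmulA k) (@Wmul1 k) (@Wmulr1 k)
    (@WmulV k) (@WmulrV k).

Definition sgen (k : nat) (i : 'I_k.+1) : affsym k := Wword [:: i].

Lemma ex_word_size (k : nat) (w : affsym k) :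
  exists n, `[< exists2 s, Wword s = w & size s = n >].
Proof.
by exists (size (repr w)); apply/asboolP; exists (repr w); rewrite ?Wword_repr.
Qed.

Definition len (k : nat) (w : affsym k) : nat := ex_minn (ex_word_size w).

Definition redword_of (k : nat) (w : affsym k) (s : seq 'I_k.+1) : bool :=
  (Wword s == w) && (size s == len w).

Lemma ex_redword (k : nat) (w : affsym k) : exists s, redword_of w s.
Proof.
rewrite /redword_of /len; case: ex_minnP => n /asboolP[s <- <-] _.
by exists s; rewrite !eqxx.
Qed.

(* By Matsumoto's theorem [uW] does not depend on the reduced word chosen. *)
Definition redword (k : nat) (w : affsym k) : seq 'I_k.+1 :=
  xchoose (ex_redword w).

Lemma redwordP (k : nat) (w : affsym k) : redword_of w (redword w).
Proof. exact: xchooseP. Qed.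

Lemma len_Wword (k : nat) (s : seq 'I_k.+1) : (len (Wword s) <= size s)%N.
Proof.
by rewrite /len; case: ex_minnP => n _; apply; apply/asboolP; exists s.
Qed.

Definition reflection (k : nat) (t : affsym k) : Prop :=
  exists u i, t = (u * sgen i * u^-1)%g.

Inductive bruhat_lt (k : nat) : affsym k -> affsym k -> Prop :=
| BruhatStep v t :
    reflection t -> (len v < len (v * t)%g)%N -> bruhat_lt v (v * t)%g
| BruhatTrans u v w : bruhat_lt u v -> bruhat_lt v w -> bruhat_lt u w.

Definition bruhat_cover (k : nat) (v w : affsym k) : Prop :=
  bruhat_lt v w /\ len w = (len v).+1.

Lemma finite_covers (k : nat) (w : affsym k) :
  finite_set [set v | bruhat_cover v w].
Proof.
apply: (@sub_finite_set _ _
    [set Wword (val t) | t in [set: (len w).-1.-tuple 'I_k.+1]]).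
  move=> v [_ wv]; have /andP[/eqP sv /eqP szv] := redwordP v.
  have sz : size (redword v) == (len w).-1 by rewrite wv szv.
  by exists (Tuple sz).
exact/finite_image/finite_finset.
Qed.

(* A realization of the affine Cartan matrix: h is a rational vector space and
   h^* is the space of linear forms on it. The Cartan matrix being singular,
   the independence of the simple roots is a condition; it makes the notion of
   positive root meaningful. *)
Record root_datum (k : nat) := RootDatum {
  cartan_space : vectType rat;
  coroot : 'I_k.+1 -> cartan_space;
  root : 'I_k.+1 -> 'Hom(cartan_space, rat^o);
  coroot_free : free (codom coroot);
  root_free : free (codom root);
  root_coroot : forall i j, root j (coroot i) = cartan i j
}.

Section RootDatum.
Variables (k : nat) (R : root_datum k).
Local Notation h := (cartan_space R).
Local Notation hdual := 'Hom(h, rat^o).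

Definition pairing (mu : h) (lambda : hdual) : rat := lambda mu.

Definition fundamental_weight (Lambda : hdual) : Prop :=
  exists j, forall i, pairing (coroot R i) Lambda = (i == j)%:R.

Definition refl_h (i : 'I_k.+1) (mu : h) : h :=
  mu - pairing mu (root R i) *: coroot R i.

Definition refl_hdual (i : 'I_k.+1) (lambda : hdual) : hdual :=
  lambda - pairing (coroot R i) lambda *: root R i.

(* [act_h_word] and [act_hdual_word] show that these do not depend on the
   word representing w. *)
Definition act_h (w : affsym k) (mu : h) : h := foldr refl_h mu (repr w).

Definition act_hdual (w : affsym k) (lambda : hdual) : hdual :=
  foldr refl_hdual lambda (repr w).

Lemma foldr_refl_cong (V : lmodType rat) (f : 'I_k.+1 -> V -> rat)
    (a : 'I_k.+1 -> V) :
  (forall i c x y, f i (x - c *: y) = f i x - c * f i y) ->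
  (forall i j, f i (a j) = cartan i j) ->
  forall s t x, coxeter_cong s t ->
  foldr (fun i y => y - f i y *: a i) x s =
  foldr (fun i y => y - f i y *: a i) x t.
Proof.
move=> fB fa s t x st; elim: st x => {s t}.
- move=> p l r q lr x; rewrite !foldr_cat; congr (foldr _ _ p).
  move: (foldr _ x q) => {}x.
  have f2 i : f i (a i) = 2 by rewrite fa /cartan eqxx.
  case: lr => [i|i j ij|i j ij] /=; rewrite !fB.
  + have E (b : rat) : b + (b - b * 2) = 0 by ring.
    by rewrite f2 -addrA -opprD -scalerDl E scale0r subr0.
  + have [->//|ne] := eqVneq i j.
    rewrite !fa (cartan_nadj ij ne) cartanC (cartan_nadj ij ne).
    by rewrite !mulr0 !subr0 addrAC.
  + rewrite !f2 !fa (cartanC j i) (cartan_braided ij).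
    set b := f i x; set c := f j x.
    have Ei : b - b * 2 - (c - b * -1) * -1 = c by ring.
    have Ej : c - c * 2 - (b - c * -1) * -1 = b by ring.
    rewrite Ei Ej -!addrA -!opprD; congr (x - _).
    rewrite addrCA addrA -addrA -scalerDl [RHS]addrCA -scalerDl.
    by rewrite addrC; congr (_ *: _ + _ *: _); ring.
- by [].
- by move=> s t _ IH x; rewrite IH.
- by move=> s t u _ IH1 _ IH2 x; rewrite IH1 IH2.
Qed.

Lemma act_h_word s mu : act_h (Wword s) mu = foldr refl_h mu s.
Proof.
apply: foldr_refl_cong (cong_repr s) => [i c x y|i j].
  by rewrite /pairing linearB linearZ.
by rewrite /pairing root_coroot cartanC.
Qed.

Lemma act_hdual_word s lambda :
  act_hdual (Wword s) lambda = foldr refl_hdual lambda s.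
Proof.
apply: foldr_refl_cong (cong_repr s) => [i c x y|i j].
  by rewrite /pairing !lfunE /= !lfunE /= lfunE.
exact: root_coroot.
Qed.

Definition positive_root (beta : hdual) : Prop :=
  exists c : 'I_k.+1 -> nat, beta = \sum_i (c i)%:R *: root R i.

(* If (u, i) is one presentation of the reflection v^-1 w then (u s_i, i) is
   another, with the opposite root; positivity selects the sign. *)
Definition is_cover_coroot (v w : affsym k) (mu : h) : Prop :=
  exists u i, [/\ (v^-1 * w)%g = (u * sgen i * u^-1)%g,
    positive_root (act_hdual u (root R i)) & mu = act_h u (coroot R i)].

Definition cover_coroot (v w : affsym k) : h := xget 0 (is_cover_coroot v w).

End RootDatum.

Section MalgLinear.
Variables (K : monomType) (R : comNzRingType).

Lemma malg_scaleAr (c : R) (x y : {malg R[K]}) : c *: (x * y) = x * (c *: y).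
Proof.
apply/malgP=> m; rewrite mcoeffZ.
rewrite (mcoeffMlw m (fsubset_refl _) (fsubset_refl _)).
rewrite (mcoeffMlw m (fsubset_refl _) (msuppZ_le c y)) mulr_sumr.
apply: eq_bigr => p _; rewrite mulr_sumr; apply: eq_bigr => q _.
by rewrite mcoeffZ mulrnAr mulrCA.
Qed.

Lemma malgUM (p q : K) :
  mkmalgU p 1 * mkmalgU q 1 = mkmalgU (mmul p q) 1 :> {malg R[K]}.
Proof. by rewrite malgM_def fgmulUU mulr1. Qed.

Lemma malgEZ (x : {malg R[K]}) :
  x = \sum_(m <- msupp x) mcoeff m x *: mkmalgU m 1.
Proof.
rewrite [LHS]monalgE; apply: eq_bigr => m _; apply/malgP=> n.
by rewrite mcoeffZ !mcoeffU mulrnAr mulr1.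
Qed.

Variables (V : lmodType R) (h : K -> V).

Definition malg_ext (x : {malg R[K]}) : V :=
  \sum_(m <- msupp x) mcoeff m x *: h m.

Lemma malg_extEw (d : {fset K}) x : fsubset (msupp x) d ->
  malg_ext x = \sum_(m <- d) mcoeff m x *: h m.
Proof.
move=> xd; apply: (big_fset_incl _ xd) => m _ /mcoeff_outdom ->.
by rewrite scale0r.
Qed.

Lemma malg_ext_is_linear : linear malg_ext.
Proof.
move=> c x y; pose d := fsetU (msupp x) (msupp y).
have xd : fsubset (msupp x) d by apply: fsubsetUl.
have yd : fsubset (msupp y) d by apply: fsubsetUr.
have cd : fsubset (msupp (c *: x + y)) d.
  apply: fsubset_trans (msuppD_le _ _) _; rewrite fsubUset yd.
  by rewrite (fsubset_trans (msuppZ_le _ _) xd).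
rewrite (malg_extEw cd) (malg_extEw xd) (malg_extEw yd) scaler_sumr -big_split.
by apply: eq_bigr => m _; rewrite mcoeffD mcoeffZ scalerDl scalerA.
Qed.

HB.instance Definition _ :=
  GRing.isLinear.Build R {malg R[K]} V _ malg_ext malg_ext_is_linear.

Lemma malg_extU (m : K) : malg_ext (mkmalgU m 1) = h m.
Proof.
by rewrite (malg_extEw msuppU_le) big_seq_fset1 mcoeffUU scale1r.
Qed.

Lemma malg_ext_sandwich (r : {malg R[K]}) :
  (forall p q, malg_ext (mkmalgU p 1 * r * mkmalgU q 1) = 0) ->
  forall a b, malg_ext (a * r * b) = 0.
Proof.
have ext0 (g : {malg R[K]} -> V) : {morph g : x y / x + y} ->
    (forall c x, g (c *: x) = c *: g x) ->
    (forall p, g (mkmalgU p 1) = 0) -> forall x, g x = 0.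
  move=> gD gZ gU x; have g0 : g 0 = 0 by rewrite -(scale0r 0) gZ scale0r.
  rewrite (malgEZ x) (big_morph g gD g0) big1 // => p _.
  by rewrite gZ gU scaler0.
move=> h0 a b.
apply: (ext0 (fun a => malg_ext (a * r * b))) => [x y|c x|p].
- by rewrite 2!mulrDl linearD.
- by rewrite -2!scalerAl linearZ.
apply: (ext0 (fun b => malg_ext (_ * r * b))) => [x y|c x|//].
- by rewrite mulrDr linearD.
- by rewrite -malg_scaleAr linearZ.
Qed.

End MalgLinear.

Section TwoSidedIdeal.
Variables (R : comNzRingType) (A : lalgType R) (gens : A -> Prop).

Inductive ideal : A -> Prop :=
| Ideal0 : ideal 0
| IdealD a r b x :
    gens r -> ideal x -> ideal (a * r * b + x).

Lemma idealD x y : ideal x -> ideal y -> ideal (x + y).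
Proof.
by elim=> [|a r b z rr _ IH] yI; rewrite ?add0r// -addrA; apply/IdealD/IH.
Qed.

Lemma idealM a b x : ideal x -> ideal (a * x * b).
Proof.
elim=> [|c r d y rr _ IH]; first by rewrite mulr0 mul0r; apply: Ideal0.
have E : a * (c * r * d) * b = a * c * r * (d * b) by rewrite !mulrA.
by rewrite mulrDr mulrDl E; apply: IdealD.
Qed.

Lemma idealZ c x : ideal x -> ideal (c *: x).
Proof.
by move/(idealM (c *: 1) 1); rewrite mulr1 -scalerAl mul1r.
Qed.

Lemma idealN x : ideal x -> ideal (- x).
Proof. by rewrite -scaleN1r; apply: idealZ. Qed.

Definition ideal_eq : rel A := fun x y => `[< ideal (x - y) >].

Lemma ideal_eq_equiv : equiv_class_of ideal_eq.
Proof.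
split=> [x | x y | y x z].
- by apply/asboolP; rewrite subrr; apply: Ideal0.
- by apply/asboolP/asboolP => /idealN; rewrite opprB.
- move=> /asboolP xy /asboolP yz; apply/asboolP.
  by have := idealD xy yz; rewrite addrA subrK.
Qed.

Lemma idealDB x x' y y' : ideal (x' - x) -> ideal (y' - y) ->
  ideal (x' + y' - (x + y)).
Proof. by move=> xx yy; rewrite opprD addrACA; apply: idealD. Qed.

Lemma idealNB x x' : ideal (x' - x) -> ideal (- x' - - x).
Proof. by rewrite -opprD; apply: idealN. Qed.

Lemma idealMB x x' y y' : ideal (x' - x) -> ideal (y' - y) ->
  ideal (x' * y' - x * y).
Proof.
move=> xx yy; have -> : x' * y' - x * y = 1 * (x' - x) * y' + x * (y' - y) * 1.
  by rewrite mul1r mulr1 mulrBl mulrBr addrA subrK.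
by apply: idealD; apply: idealM.
Qed.

Lemma idealZB c x x' : ideal (x' - x) -> ideal (c *: x' - c *: x).
Proof. by rewrite -scalerBr; apply: idealZ. Qed.

Lemma ideal_rmorph (f : {rmorphism A -> R}) :
  (forall r, gens r -> f r = 0) -> forall x, ideal x -> f x = 0.
Proof.
move=> f0 x; elim=> [|a r b y rr _ IH]; first exact: rmorph0.
by rewrite rmorphD !rmorphM (f0 _ rr) IH mulr0 mul0r addr0.
Qed.

End TwoSidedIdeal.

Section NilRelators.
Variables (k : nat) (R : comNzRingType) (A : lalgType R) (x : 'I_k.+1 -> A).

Inductive nil_relator : A -> Prop :=
| NilSquare i : nil_relator (x i * x i)
| NilComm i j : ~~ adjacent i j -> nil_relator (x i * x j - x j * x i)
| NilBraid i j : braided i j ->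
    nil_relator (x i * x j * x i - x j * x i * x j).

Lemma nil_relator_rmorph (f : {rmorphism A -> R}) :
  (forall i, f (x i) = 0) -> forall r, nil_relator r -> f r = 0.
Proof.
move=> fx r [i|i j _|i j _]; rewrite ?rmorphB !rmorphM !fx.
all: by rewrite !(mulr0, subrr).
Qed.

Lemma nil_relator_word (V : lmodType R) (f : {linear A -> V})
    (xw := fun s => \prod_(i <- s) x i) :
  (forall p i q, f (xw (p ++ [:: i; i] ++ q)) = 0) ->
  (forall s t, coxeter_cong s t -> size s = size t -> f (xw s) = f (xw t)) ->
  forall r, nil_relator r -> forall p q, f (xw p * r * xw q) = 0.
Proof.
move=> fsq fcong r rr p q.
have E2 i j : x i * x j = xw [:: i; j] by rewrite /xw big_cons big_seq1.
have E3 i j l : x i * x j * x l = xw [:: i; j; l].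
  by rewrite /xw !big_cons big_nil mulr1 mulrA.
have E l : xw p * xw l * xw q = xw (p ++ l ++ q).
  by rewrite /xw !big_cat /= mulrA.
have EB s t : f (xw p * (xw s - xw t) * xw q) =
    f (xw (p ++ s ++ q)) - f (xw (p ++ t ++ q)).
  by rewrite mulrBr mulrBl linearB !E.
case: rr => [i|i j ij|i j ij].
- by rewrite E2 E fsq.
- rewrite !E2 EB; apply/eqP; rewrite subr_eq0; apply/eqP/fcong.
    exact/(@CoxStep _ p [:: i; j] [:: j; i])/CoxComm.
  by rewrite !size_cat.
- rewrite !E3 EB; apply/eqP; rewrite subr_eq0; apply/eqP/fcong.
    exact/(@CoxStep _ p [:: i; j; i] [:: j; i; j])/CoxBraid.
  by rewrite !size_cat.
Qed.

End NilRelators.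

Section FreeAlgebra.
Variables (k : nat) (R : comNzRingType).
Local Notation freealg := {malg R[{fmonom 'I_k.+1}]}.

Definition fgen (i : 'I_k.+1) : freealg := mkmalgU (FMonom [:: i]) 1.

Lemma fgen_word (s : seq 'I_k.+1) :
  \prod_(i <- s) fgen i = mkmalgU (FMonom s) 1.
Proof.
elim: s => [|i s IH]; first by rewrite big_nil -fmoneE.
by rewrite big_cons IH malgUM; congr mkmalgU; apply: fmmulE.
Qed.

Lemma malg_ext_ideal (V : lmodType R) (h : {fmonom 'I_k.+1} -> V) :
  (forall p i q, h (FMonom (p ++ [:: i; i] ++ q)) = 0) ->
  (forall s t, coxeter_cong s t -> size s = size t ->
     h (FMonom s) = h (FMonom t)) ->
  forall x, ideal (nil_relator fgen) x -> malg_ext h x = 0.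
Proof.
move=> hsq hcong.
have hw s : malg_ext h (\prod_(i <- s) fgen i) = h (FMonom s).
  by rewrite fgen_word malg_extU.
have hr r : nil_relator fgen r -> forall p q,
    malg_ext h (\prod_(i <- p) fgen i * r * \prod_(i <- q) fgen i) = 0.
  apply: nil_relator_word => [p i q|s t st sz].
    exact: etrans (hw _) (hsq p i q).
  exact: etrans (hw s) (etrans (hcong s t st sz) (esym (hw t))).
move=> x; elim=> [|a r b y rr _ IH]; first exact: linear0.
rewrite linearD /= IH addr0; apply: malg_ext_sandwich => -[p] [q].
by rewrite -!fgen_word hr.
Qed.

End FreeAlgebra.

Section NilCoxeter.
Variable k : nat.

Local Notation freealg := {malg rat[{fmonom 'I_k.+1}]}.

Local Notation fgen := (@fgen k rat).

Definition nil_eq : rel freealg := ideal_eq (nil_relator fgen).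

Canonical nil_eq_equivRel := EquivRelPack (ideal_eq_equiv (nil_relator fgen)).

Definition nilcox := {eq_quot nil_eq}.

HB.instance Definition _ := Choice.on nilcox.

Definition nclass : freealg -> nilcox := locked (fun x => \pi_nilcox x).

Lemma nclassP x y : nclass x = nclass y <-> ideal (nil_relator fgen) (x - y).
Proof.
rewrite /nclass -lock.
by split=> [/eqmodP/asboolP//|xy]; apply/eqmodP/asboolP.
Qed.

Lemma nclass_repr (x : nilcox) : nclass (repr x) = x.
Proof. by rewrite /nclass -lock; apply: reprK. Qed.

Lemma nil_ideal_repr x : ideal (nil_relator fgen) (repr (nclass x) - x).
Proof. by apply/nclassP; rewrite nclass_repr. Qed.

(* The operations are locked: unfolding them during unification would send
   the kernel computing in the free algebra over rat. *)
Definition nadd : nilcox -> nilcox -> nilcox :=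
  locked (fun x y => nclass (repr x + repr y)).
Definition nopp : nilcox -> nilcox := locked (fun x => nclass (- repr x)).
Definition nmul : nilcox -> nilcox -> nilcox :=
  locked (fun x y => nclass (repr x * repr y)).
Definition nscale : rat -> nilcox -> nilcox :=
  locked (fun c x => nclass (c *: repr x)).

Fact naddE x y : nadd (nclass x) (nclass y) = nclass (x + y).
Proof.
by rewrite /nadd -lock; apply/nclassP/idealDB; apply: nil_ideal_repr.
Qed.

Fact noppE x : nopp (nclass x) = nclass (- x).
Proof. by rewrite /nopp -lock; apply/nclassP/idealNB/nil_ideal_repr. Qed.

Fact nmulE x y : nmul (nclass x) (nclass y) = nclass (x * y).
Proof.
by rewrite /nmul -lock; apply/nclassP/idealMB; apply: nil_ideal_repr.
Qed.

Fact nscaleE c x : nscale c (nclass x) = nclass (c *: x).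
Proof. by rewrite /nscale -lock; apply/nclassP/idealZB/nil_ideal_repr. Qed.

Lemma nclassW (P : nilcox -> Prop) : (forall x, P (nclass x)) -> forall x, P x.
Proof. by move=> H x; rewrite -(nclass_repr x). Qed.

Fact naddA : associative nadd.
Proof.
by elim/nclassW=> x; elim/nclassW=> y; elim/nclassW=> z; rewrite !naddE addrA.
Qed.

Fact naddC : commutative nadd.
Proof. by elim/nclassW=> x; elim/nclassW=> y; rewrite !naddE addrC. Qed.

Fact nadd0 : left_id (nclass 0) nadd.
Proof. by elim/nclassW=> x; rewrite naddE add0r. Qed.

Fact naddN : left_inverse (nclass 0) nopp nadd.
Proof. by elim/nclassW=> x; rewrite noppE naddE addNr. Qed.

HB.instance Definition _ := GRing.isZmodule.Build nilcox naddA naddC nadd0 naddN.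

Fact nclassD x y : nclass x + nclass y = nclass (x + y).
Proof. exact: naddE. Qed.

Fact nmulA : associative nmul.
Proof.
by elim/nclassW=> x; elim/nclassW=> y; elim/nclassW=> z; rewrite !nmulE mulrA.
Qed.

Fact nmul1 : left_id (nclass 1) nmul.
Proof. by elim/nclassW=> x; rewrite nmulE mul1r. Qed.

Fact nmulr1 : right_id (nclass 1) nmul.
Proof. by elim/nclassW=> x; rewrite nmulE mulr1. Qed.

Fact nmulDl : left_distributive nmul +%R.
Proof.
elim/nclassW=> x; elim/nclassW=> y; elim/nclassW=> z.
by rewrite nclassD !nmulE nclassD mulrDl.
Qed.

Fact nmulDr : right_distributive nmul +%R.
Proof.
elim/nclassW=> x; elim/nclassW=> y; elim/nclassW=> z.
by rewrite nclassD !nmulE nclassD mulrDr.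
Qed.

(* The constant coefficient vanishes on the ideal. *)
Fact none_neq0 : nclass 1 != nclass 0.
Proof.
apply/eqP => /nclassP; rewrite subr0.
pose eps : {rmorphism freealg -> rat} := mcoeff (mone : {fmonom 'I_k.+1}).
have e0 i : eps (fgen i) = 0 by rewrite /= /fgen -fmuE mcoeffU fm1_eq1.
move/(ideal_rmorph (nil_relator_rmorph e0)).
by rewrite rmorph1 => /eqP; rewrite oner_eq0.
Qed.

HB.instance Definition _ := GRing.Zmodule_isNzRing.Build nilcox
  nmulA nmul1 nmulr1 nmulDl nmulDr none_neq0.

Fact nclassM x y : nclass x * nclass y = nclass (x * y).
Proof. exact: nmulE. Qed.

Fact nscaleA c d x : nscale c (nscale d x) = nscale (c * d) x.
Proof. by elim/nclassW: x => x; rewrite !nscaleE scalerA. Qed.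

Fact nscale1 : left_id 1 nscale.
Proof. by elim/nclassW=> x; rewrite nscaleE scale1r. Qed.

Fact nscaleDr : right_distributive nscale +%R.
Proof.
move=> c; elim/nclassW=> x; elim/nclassW=> y.
by rewrite nclassD !nscaleE nclassD scalerDr.
Qed.

Fact nscaleDl x : {morph nscale^~ x : c d / c + d}.
Proof.
by elim/nclassW: x => x c d; rewrite !nscaleE nclassD scalerDl.
Qed.

HB.instance Definition _ := GRing.Zmodule_isLmodule.Build rat nilcox
  nscaleA nscale1 nscaleDr nscaleDl.

Fact nclassZ c x : c *: nclass x = nclass (c *: x).
Proof. exact: nscaleE. Qed.

Fact nscaleAl c (x y : nilcox) : c *: (x * y) = c *: x * y.
Proof.
elim/nclassW: x => x; elim/nclassW: y => y.
by rewrite nclassM !nclassZ nclassM scalerAl.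
Qed.

HB.instance Definition _ := GRing.Lmodule_isLalgebra.Build rat nilcox nscaleAl.

Fact nscaleAr c (x y : nilcox) : c *: (x * y) = x * (c *: y).
Proof.
elim/nclassW: x => x; elim/nclassW: y => y.
by rewrite nclassM !nclassZ nclassM malg_scaleAr.
Qed.

HB.instance Definition _ := GRing.Lalgebra_isAlgebra.Build rat nilcox nscaleAr.

Fact nclass_is_linear : linear nclass.
Proof. by move=> c x y; rewrite nclassZ nclassD. Qed.

HB.instance Definition _ :=
  GRing.isLinear.Build rat freealg nilcox _ nclass nclass_is_linear.

Fact nclass_is_multiplicative : monoid_morphism nclass.
Proof. by split; [exact: erefl | move=> x y; rewrite nclassM]. Qed.

HB.instance Definition _ :=
  GRing.isMonoidMorphism.Build freealg nilcox nclass nclass_is_multiplicative.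

Definition ugen (i : 'I_k.+1) : nilcox := locked (nclass (fgen i)).

Definition uword (s : seq 'I_k.+1) : nilcox := \prod_(i <- s) ugen i.

Definition uW (w : affsym k) : nilcox := uword (redword w).

End NilCoxeter.

Section Down.
Variables (k : nat) (R : root_datum k) (Lambda : 'Hom(cartan_space R, rat^o)).
Local Notation freealg := {malg rat[{fmonom 'I_k.+1}]}.

(* D_Lambda(u_w); the sum is finite by [finite_covers]. *)
Definition down_basis (w : affsym k) : nilcox k :=
  \sum_(v \in [set v | bruhat_cover v w])
    pairing (cover_coroot R v w) Lambda *: uW v.

(* A word of generators is u_w if it is a reduced word of w, and 0 if it is not
   reduced. [down_uW] below is the defining property of D_Lambda. *)
Definition down_word (s : seq 'I_k.+1) : nilcox k :=
  if redword_of (Wword s) s then down_basis (Wword s) else 0.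

Definition down (x : nilcox k) : nilcox k :=
  malg_ext (fun m : {fmonom 'I_k.+1} => down_word m) (repr x).

Lemma down_word_eq s t : coxeter_cong s t -> size s = size t ->
  down_word s = down_word t.
Proof. by move=> /WwordP st szst; rewrite /down_word /redword_of st szst !eqxx. Qed.

Lemma down_word_sq p i q : down_word (p ++ [:: i; i] ++ q) = 0.
Proof.
rewrite /down_word /redword_of eqxx /=.
have -> : Wword (p ++ i :: i :: q) = Wword (p ++ q).
  exact/WwordP/(@CoxStep _ p [:: i; i] [::] q (CoxSquare i)).
rewrite ifF //; apply/negbTE; rewrite neq_ltn; apply/orP; right.
by apply: leq_ltn_trans (len_Wword _) _; rewrite !size_cat /= !addnS ltnS leqnSn.
Qed.

Lemma down_nclass (x : freealg) :
  down (nclass x) = malg_ext (fun m : {fmonom 'I_k.+1} => down_word m) x.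
Proof.
apply/eqP; rewrite -subr_eq0 -linearB; apply/eqP.
apply: malg_ext_ideal (nil_ideal_repr x) => [p i q|s t]; first exact: down_word_sq.
exact: down_word_eq.
Qed.

Lemma down_is_linear : linear down.
Proof.
move=> c; elim/nclassW=> x; elim/nclassW=> y.
by rewrite nclassZ nclassD !down_nclass linearP.
Qed.

HB.instance Definition _ :=
  GRing.isLinear.Build rat (nilcox k) (nilcox k) _ down down_is_linear.

Lemma uword_nclass (s : seq 'I_k.+1) :
  uword s = nclass (mkmalgU (FMonom s) 1).
Proof.
rewrite -fgen_word rmorph_prod; apply: eq_bigr => i _.
by rewrite /ugen -lock.
Qed.

Lemma down_uW (w : affsym k) : down (uW w) = down_basis w.
Proof.
rewrite /uW uword_nclass down_nclass malg_extU /down_word.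
by have /andP[/eqP-> ww] := redwordP w; rewrite redwordP.
Qed.

End Down.

Definition cyc_decreasing (k : nat) (S : {set 'I_k.+1}) (w : affsym k) : Prop :=
  forall s, redword_of w s ->
    [/\ uniq s, s =i S &
      forall j, j \in S -> ordS j \in S -> (index (ordS j) s < index j s)%N].

Definition wS (k : nat) (S : {set 'I_k.+1}) : affsym k :=
  xget 1%g (cyc_decreasing S).

Definition uS (k : nat) (S : {set 'I_k.+1}) : nilcox k := uW (wS S).

Definition hh (k : nat) (i : nat) : nilcox k :=
  \sum_(S : {set 'I_k.+1} | (S \proper [set: 'I_k.+1]) && (#|S| == i)) uS S.

Definition U_op (k : nat) (m : nat) (x : nilcox k) : nilcox k := hh k m * x.

(* Main.v *)
(* The idea: the action of weights on the nilCoxeter algebra turns D into a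
   twisted derivation. For any word s = s_1 ... s_n, reduced or not,
     D_lam(u_s) = sum_m <al_(s_m)^v, s_(m+1) ... s_n lam> u_(s with s_m deleted):
   for reduced s this is the strong exchange condition, deletions that are not
   reduced having u = 0. Hence D_lam(u_p u_s) = D_(s lam)(u_p) u_s + u_p D_lam(u_s),
   and everything reduces to D_mu(h_i) = level(mu) h_(i-1), where the level
   sum_j <al_j^v, mu> is W-invariant and equals 1 on a fundamental weight. For
   that identity, deleting i from a cyclically decreasing word on T + i produces
   u_T with coefficient the sum of mu_j over the maximal interval
   j, j + 1, ..., i all of whose elements but the last lie in T; when T is fixed
   and i runs over the complement of T these intervals partition Z/(k+1).

   The exchange condition is obtained from the root lattice: an induction on
   length shows that w al_i > 0 as soon as l(w s_i) > l(w). Matsumoto's theorem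
   follows by the usual induction, the case k = 1 (no braid relation) being
   excluded by the invariance of al_0 + al_1. *)

From HB Require Import structures.
From mathcomp Require Import all_boot all_order all_algebra.
From mathcomp Require Import finmap boolp classical_sets cardinality fsbigop.
From mathcomp Require Import monalg ring zify.
Require Import Defs.

Set Implicit Arguments.
Unset Strict Implicit.
Unset Printing Implicit Defensive.

Import Order.TTheory GRing.Theory Num.Theory.
Local Open Scope ring_scope.

(** * Length, parity and descents in the affine symmetric group *)

Section Length.
Variable k : nat.
Implicit Types (u v w : affsym k) (s t : seq 'I_k.+1) (i j : 'I_k.+1).

Lemma Wword_cat s t : Wword (s ++ t) = (Wword s * Wword t)%g.
Proof. by rewrite -WmulE. Qed.

Lemma Wword_cons i s : Wword (i :: s) = (sgen i * Wword s)%g.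
Proof. by rewrite -Wword_cat. Qed.

Lemma Wword_rcons i s : Wword (rcons s i) = (Wword s * sgen i)%g.
Proof. by rewrite -cats1 Wword_cat. Qed.

Lemma Wword_nil : Wword [::] = 1%g :> affsym k.
Proof. by []. Qed.

Lemma sgenK i : (sgen i * sgen i)%g = 1%g.
Proof.
by rewrite -Wword_cons; apply/WwordP/(@CoxStep _ [::] [:: i; i] [::] [::])/CoxSquare.
Qed.

Lemma sgenV i : ((sgen i)^-1)%g = sgen i.
Proof. by apply: mulg1_eq; rewrite sgenK. Qed.

Lemma sgenKr w i : (w * sgen i * sgen i)%g = w.
Proof. by rewrite -mulgA sgenK mulg1. Qed.

Lemma sgenKl w i : (sgen i * (sgen i * w))%g = w.
Proof. by rewrite mulgA sgenK mul1g. Qed.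

Lemma sgen_comm i j : ~~ adjacent i j -> (sgen i * sgen j)%g = (sgen j * sgen i)%g.
Proof.
move=> ij; rewrite -!Wword_cons.
exact/WwordP/(@CoxStep _ [::] [:: i; j] [:: j; i] [::])/CoxComm.
Qed.

Lemma sgen_braid i j : braided i j ->
  (sgen i * (sgen j * sgen i))%g = (sgen j * (sgen i * sgen j))%g.
Proof.
have E a b c : (sgen a * (sgen b * sgen c))%g = Wword [:: a; b; c] :> affsym k.
  by rewrite 2!Wword_cons.
move=> ij; rewrite !E.
exact/WwordP/(@CoxStep _ [::] [:: i; j; i] [:: j; i; j] [::])/CoxBraid.
Qed.

Lemma ex_reduced w : exists2 s, Wword s = w & size s = len w.
Proof. by have /andP[/eqP sw /eqP] := redwordP w; exists (redword w). Qed.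

Lemma Wword_rev s : Wword (rev s) = ((Wword s)^-1)%g.
Proof. by rewrite -WinvE. Qed.

Lemma len_inv w : len (w^-1)%g = len w.
Proof.
have le u : (len (u^-1)%g <= len u)%N.
  by have [s <- <-] := ex_reduced u; rewrite -Wword_rev -(size_rev s) len_Wword.
by apply/eqP; rewrite eqn_leq le -{1}(invgK w) le.
Qed.

Lemma len_mul v w : (len (v * w)%g <= len v + len w)%N.
Proof.
have [s <- <-] := ex_reduced v; have [t <- <-] := ex_reduced w.
by rewrite -Wword_cat -size_cat len_Wword.
Qed.

Lemma len_sgen i : (len (sgen i) <= 1)%N.
Proof. exact: len_Wword [:: i]. Qed.

Lemma len_sgenr w i : (len (w * sgen i)%g <= (len w).+1)%N.
Proof. by rewrite -addn1 (leq_trans (len_mul _ _)) // leq_add2l len_sgen. Qed.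

Lemma len1 : len (1%g : affsym k) = 0%N.
Proof. by apply/eqP; rewrite -leqn0 -Wword_nil len_Wword. Qed.

(** Both sides of every Coxeter relation have lengths of the same parity, so multiplication by a
    generator never preserves the length. *)
Lemma odd_len s : odd (len (Wword s)) = odd (size s).
Proof.
have odd_cong (u t : seq _) : @coxeter_cong k u t -> odd (size u) = odd (size t).
  elim=> {u t} [a l r b lr|//|u t _ -> //|u t u' _ -> _ -> //].
  by rewrite !size_cat !oddD; case: lr.
by have [t /WwordP/odd_cong <- ->] := ex_reduced (Wword s).
Qed.

Lemma odd_len_sgenr w i : odd (len (w * sgen i)%g) = ~~ odd (len w).
Proof.
by have [s <- <-] := ex_reduced w; rewrite -Wword_rcons odd_len size_rcons.
Qed.

Lemma len_sgenr_ltn w i :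
  (len (w * sgen i)%g < len w)%N = ~~ (len w < len (w * sgen i)%g)%N.
Proof. by have := odd_len_sgenr w i; case: ltngtP => // ->; case: odd. Qed.

Lemma len_sgenl_ltn w i :
  (len (sgen i * w)%g < len w)%N = ~~ (len w < len (sgen i * w)%g)%N.
Proof.
have := len_sgenr_ltn (w^-1)%g i.
have -> : (w^-1 * sgen i)%g = ((sgen i * w)^-1)%g by rewrite invgM sgenV.
by rewrite !len_inv.
Qed.

Lemma len_sgenr_gt w i : (len w < len (w * sgen i)%g)%N ->
  len (w * sgen i)%g = (len w).+1.
Proof. by move=> lt; apply/eqP; rewrite eqn_leq lt len_sgenr. Qed.

Lemma len_sgenr_lt w i : (len (w * sgen i)%g < len w)%N ->
  len w = (len (w * sgen i)%g).+1.
Proof.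
by move=> lt; have := @len_sgenr_gt (w * sgen i)%g i; rewrite sgenKr; apply.
Qed.

Lemma ex_descent w : w != 1%g -> exists i, (len (w * sgen i)%g < len w)%N.
Proof.
have [s] := ex_reduced w; case/lastP: s => [<-|s i <- <- _]; first by rewrite eqxx.
by exists i; rewrite Wword_rcons sgenKr size_rcons ltnS len_Wword.
Qed.

Definition reduced s := size s == len (Wword s).

Lemma reduced_word w : exists2 s, Wword s = w & reduced s.
Proof. by have [s <- ss] := ex_reduced w; exists s; rewrite // /reduced ss. Qed.

Lemma reduced_catr s t : reduced (s ++ t) -> reduced t.
Proof.
rewrite /reduced !eqn_leq !len_Wword !andbT Wword_cat size_cat => h.
have := leq_trans h (len_mul _ _); have := len_Wword s; lia.
Qed.

Lemma reduced_cons i s : reduced (i :: s) =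
  reduced s && (len (Wword s) < len (sgen i * Wword s)%g)%N.
Proof.
apply/idP/andP=> [h|[/eqP hs h]].
  have hs := @reduced_catr [:: i] s h; split=> //.
  by move: h hs; rewrite /reduced Wword_cons => /eqP <- /eqP <-.
by rewrite /reduced eqn_leq len_Wword andbT /= hs Wword_cons.
Qed.

End Length.

(** * Root lattice, positivity of roots and the strong exchange condition *)

(* Since the Cartan matrix is symmetric, one copy of the lattice, with basis
   [al], serves both for the roots in h^* and for the coroots in h. *)
Section RootLattice.
Variable k : nat.
Local Notation V := 'rV[rat]_k.+1.
Implicit Types (u v w : affsym k) (s t : seq 'I_k.+1) (i j : 'I_k.+1) (x y : V).

Definition al i : V := delta_mx 0 i.
Definition cartan_mx : 'M[rat]_k.+1 := \matrix_(i, j) cartan i j.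
Definition cform x y : rat := (x *m cartan_mx *m y^T) 0 0.
Definition rf i x : V := x - cform (al i) x *: al i.
Definition ract w x : V := foldr rf x (repr w).

Lemma cformDl x y z : cform (x + y) z = cform x z + cform y z.
Proof. by rewrite /cform !mulmxDl [LHS]mxE. Qed.
Lemma cformZl c x z : cform (c *: x) z = c * cform x z.
Proof. by rewrite /cform -!scalemxAl [LHS]mxE. Qed.
Lemma cformC x y : cform x y = cform y x.
Proof.
rewrite /cform -[_ *m _ *m y^T]trmxK [LHS]mxE !trmx_mul trmxK mulmxA.
congr ((_ *m _ *m _) 0 0); by apply/matrixP=> i j; rewrite !mxE cartanC.
Qed.
Lemma cformDr x y z : cform z (x + y) = cform z x + cform z y.
Proof. by rewrite cformC cformDl !(cformC _ z). Qed.
Lemma cformZr c x z : cform z (c *: x) = c * cform z x.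
Proof. by rewrite cformC cformZl cformC. Qed.
Lemma cformNr x z : cform z (- x) = - cform z x.
Proof. by rewrite -scaleN1r cformZr mulN1r. Qed.
Lemma cformNl x z : cform (- x) z = - cform x z.
Proof. by rewrite cformC cformNr cformC. Qed.

Lemma cform_al i j : cform (al i) (al j) = cartan i j.
Proof. by rewrite /cform -rowE trmx_delta -colE !mxE. Qed.

Lemma cform_alii i : cform (al i) (al i) = 2.
Proof. by rewrite cform_al /cartan eqxx. Qed.

Lemma rf_is_linear i : linear (rf i).
Proof.
move=> c x y; rewrite /rf cformDr cformZr scalerBr scalerDl !scalerA.
by rewrite opprD addrACA.
Qed.
HB.instance Definition _ i :=
  GRing.isLinear.Build rat V V _ (rf i) (rf_is_linear i).

Lemma cform_rf i x y : cform (rf i x) (rf i y) = cform x y.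
Proof.
rewrite /rf !(cformDr, cformDl, cformNl, cformNr, cformZl, cformZr) cform_alii.
rewrite (cformC x (al i)); ring.
Qed.

Lemma rf_al i : rf i (al i) = - al i.
Proof. by rewrite /rf cform_alii scaler_nat mulr2n opprD addrA subrr sub0r. Qed.

Lemma ract_word s x : ract (Wword s) x = foldr rf x s.
Proof.
rewrite /ract.
apply: (@foldr_refl_cong k V (fun i y => cform (al i) y) al _ _ _ _ _ (cong_repr s)).
- by move=> i c y z; rewrite cformDr cformNr cformZr.
- exact: cform_al.
Qed.

Lemma ractM v w x : ract (v * w)%g x = ract v (ract w x).
Proof.
have [s <- _] := ex_reduced v; have [t <- _] := ex_reduced w.
by rewrite -Wword_cat !ract_word foldr_cat.
Qed.

Lemma ract1 x : ract 1%g x = x.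
Proof. by rewrite -Wword_nil ract_word. Qed.

Lemma ract_sgen i x : ract (sgen i) x = rf i x.
Proof. exact: (ract_word [:: i]). Qed.

Lemma ractK w x : ract w^-1%g (ract w x) = x.
Proof. by rewrite -ractM mulVg ract1. Qed.

Lemma ractVK w x : ract w (ract w^-1%g x) = x.
Proof. by rewrite -ractM mulgV ract1. Qed.

Lemma ract_is_linear w : linear (ract w).
Proof.
have [s <- _] := ex_reduced w; move=> c x y; rewrite !ract_word.
by elim: s => //= i s ->; rewrite linearP.
Qed.
HB.instance Definition _ w :=
  GRing.isLinear.Build rat V V _ (ract w) (ract_is_linear w).

Lemma cform_ract w x y : cform (ract w x) (ract w y) = cform x y.
Proof.
have [s <- _] := ex_reduced w; rewrite !ract_word.
by elim: s => //= i s IH; rewrite cform_rf.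
Qed.

(* Nonnegative integral coordinates, as in [positive_root]. *)
Definition pos x := forall j, x 0 j \is a Num.nat.

Lemma pos_al i : pos (al i).
Proof. by move=> j; rewrite mxE eqxx; case: eqP. Qed.

Lemma posD x y : pos x -> pos y -> pos (x + y).
Proof. by move=> px py j; rewrite mxE rpredD. Qed.

Lemma posMn x n : pos x -> pos (x *+ n).
Proof. by move=> px j; rewrite mulmxnE rpredMn. Qed.

Lemma al_neq0 i : al i != 0.
Proof.
by apply/eqP => /matrixP/(_ 0 i); rewrite !mxE !eqxx => /eqP; rewrite oner_eq0.
Qed.

Lemma ract_al_neq0 w i : ract w (al i) != 0.
Proof.
apply: contra_neq (al_neq0 i) => /(congr1 (ract w^-1%g)).
by rewrite ractK raddf0.
Qed.

Lemma pos_oppF x : pos x -> pos (- x) -> x = 0.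
Proof.
move=> px pnx; apply/rowP=> j; rewrite [RHS]mxE; apply/le_anti.
by have := natr_ge0 (pnx j); rewrite [(- x) 0 j]mxE oppr_ge0 => ->; rewrite natr_ge0.
Qed.

Lemma leq1_eq1 i j : (k <= 1)%N -> i != j -> k = 1%N.
Proof.
move=> k1 ij; apply/eqP; rewrite eqn_leq k1 lt0n; apply: contra ij => /eqP k0.
by clear -k0; subst k; rewrite !ord1.
Qed.

Lemma cartan_k1 i j : k = 1%N -> i != j -> cartan i j = - 2.
Proof.
move=> k1 ij; have ad : adjacent i j.
  by clear -k1 ij; subst k; move: i j ij => [[|[]]// hi] [[|[]]// hj].
have k1b : (k == 1)%N by apply/eqP.
by rewrite /cartan (negPf ij) ad k1b.
Qed.

Lemma rf_pair i j : k = 1%N -> i != j -> rf i (al i + al j) = al i + al j.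
Proof.
move=> k1 ij; rewrite /rf cformDr cform_alii cform_al cartan_k1 //.
by rewrite addrN scale0r subr0.
Qed.

(** For [k = 1] this vector is the null root: the form pairs it to zero with both simple roots. *)
Lemma ract_pair i j w : k = 1%N -> i != j -> ract w (al i + al j) = al i + al j.
Proof.
move=> k1 ij; have [s <- _] := ex_reduced w; rewrite ract_word.
elim: s => //= l s ->.
have [->|li] := eqVneq l i; first exact: rf_pair.
have -> : l = j; last by rewrite addrC rf_pair // eq_sym.
clear -k1 li ij; subst k; apply/val_inj.
by move: i j l ij li => [[|[]]// hi] [[|[]]// hj] [[|[]]// hl].
Qed.

(* Write w = v s_j. If l(v s_i) > l(v), then w al_i is a nonnegative combination of
   v al_i and v al_j. Otherwise v = u s_i, and w al_i is u al_j when s_i and s_j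
   satisfy a braid relation, and u al_i + 2 (al_i + al_j) when k = 1. *)
Lemma pos_ract w i : (len w < len (w * sgen i)%g)%N -> pos (ract w (al i)).
Proof.
have [n] := ubnP (len w); elim: n => // n IH in w i *; rewrite ltnS => wn wi.
have [->|w1] := eqVneq w 1%g; first by rewrite ract1; apply: pos_al.
have [j wj] := ex_descent w1.
have ij : i != j by apply: contraTneq wi => ->; rewrite -leqNgt ltnW.
have [v vE] : exists v, v = (w * sgen j)%g by eexists.
have wE : w = (v * sgen j)%g by rewrite vE sgenKr.
have lw : len w = (len v).+1 by rewrite vE; apply: len_sgenr_lt.
have vn : (len v < n)%N by rewrite -ltnS -lw.
have IHv l : (len v < len (v * sgen l)%g)%N -> pos (ract v (al l)) by apply: IH.
have pvj : pos (ract v (al j)) by apply: IHv; rewrite -wE lw.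
rewrite wE ractM ract_sgen /rf cform_al cartanC linearB linearZ /=.
have [vi|] := ltnP (len v) (len (v * sgen i)%g).
  have [nadj|ad] := boolP (adjacent i j); last first.
    by rewrite cartan_nadj // scale0r subr0; apply: IHv.
  rewrite /cartan (negPf ij) nadj -scaleNr; apply: posD; first exact: IHv.
  by case: ifP => _; rewrite opprK ?scale1r // scaler_nat; apply: posMn.
rewrite leqNgt -len_sgenr_ltn => vi.
have [u uE] : exists u, u = (v * sgen i)%g by eexists.
have vEu : v = (u * sgen i)%g by rewrite uE sgenKr.
have lv : len v = (len u).+1 by rewrite uE; apply: len_sgenr_lt.
have un : (len u < n)%N by apply: ltnW; rewrite -lv.
have [ad|nadj] := boolP (adjacent i j); last first.
  (* Commuting letters give w s_i = u s_j, which is shorter than w. *)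
  have : (len (w * sgen i)%g <= len u + 1)%N.
    rewrite wE vEu -!mulgA (mulgA (sgen i)) (sgen_comm nadj) -mulgA sgenK mulg1.
    exact: leq_trans (len_mul _ _) (leq_add (leqnn _) (len_sgen _)).
  by rewrite leqNgt addn1 -lv (ltn_trans _ wi) // lw.
have [k1|k1] := ltnP 1 k.
  have br : braided i j by rewrite /braided ad k1.
  rewrite (cartan_braided br) scaleN1r opprK -(linearD (ract v)) vEu /= ractM ract_sgen.
  have -> : rf i (al i + al j) = al j.
    rewrite linearD /= rf_al /rf cform_al (cartan_braided br) scaleN1r opprK.
    by rewrite addrCA addNr addr0.
  (* If u s_j were shorter than u, say u = x s_j, the braid relation would give w s_i = x s_i s_j,
     shorter than w. *)
  apply: IH => //; apply: contraTT wi; rewrite -len_sgenr_ltn -leqNgt => uj.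
  have lu := len_sgenr_lt uj; set x := (u * sgen j)%g in lu.
  have uEx : u = (x * sgen j)%g by rewrite /x sgenKr.
  have -> : (w * sgen i)%g = (x * (sgen i * sgen j))%g.
    by rewrite wE vEu uEx -!mulgA (sgen_braid br) sgenKl.
  have := len_mul x (sgen i * sgen j)%g; have := len_mul (sgen i) (sgen j).
  by have := len_sgen i; have := len_sgen j; lia.
have {}k1 := leq1_eq1 k1 ij.
have -> : ract v (al i) - cartan i j *: ract v (al j) =
          ract u (al i) + (al i + al j) *+ 2.
  have ri : ract v (al i) = - ract u (al i).
    by rewrite vEu ractM ract_sgen rf_al linearN.
  have -> : ract v (al j) = al i + al j + ract u (al i).
    by rewrite -(ract_pair v k1 ij) linearD /= ri addrAC addNr add0r.
  rewrite ri cartan_k1 // scaleNr opprK scaler_nat mulrnDl addrCA addrC.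
  by rewrite [ract u _ *+ 2]mulr2n addKr.
apply: posD; last by apply/posMn/posD; apply: pos_al.
by apply: IH => //; rewrite -vEu lv.
Qed.

Lemma neg_ract w i : (len (w * sgen i)%g < len w)%N -> pos (- ract w (al i)).
Proof.
move=> h; rewrite -linearN /= -rf_al -ract_sgen -ractM; apply: pos_ract.
by rewrite sgenKr.
Qed.

(** A descent makes the root negative, and a nonzero vector is not both positive and negative. *)
Lemma posP w i : pos (ract w (al i)) <-> (len w < len (w * sgen i)%g)%N.
Proof.
split; last exact: pos_ract.
apply: contraPT; rewrite -len_sgenr_ltn => /neg_ract n p.
by have/eqP := ract_al_neq0 w i; apply; apply: pos_oppF.
Qed.

Lemma not_pos_neg w i : ~ pos (ract w (al i)) -> pos (- ract w (al i)).
Proof.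
by move=> h; apply: neg_ract; rewrite len_sgenr_ltn; apply/negP => /posP.
Qed.

(** A nontrivial w has a descent i and sends al_i to a negative root, hence moves it. *)
Lemma ract_faithful w : (forall x, ract w x = x) -> w = 1%g.
Proof.
move=> h; apply/eqP; apply: contraT => /ex_descent[i /neg_ract]; rewrite h.
move=> /(pos_oppF (@pos_al i)) /eqP; by rewrite (negPf (al_neq0 i)).
Qed.

Lemma ract_inj v w : (forall x, ract v x = ract w x) -> v = w.
Proof.
move=> h; apply/esym/eqP; rewrite -divg_eq1; apply/eqP/ract_faithful => x.
by rewrite ractM -h ractVK.
Qed.

Lemma sgen_inj : injective (@sgen k).
Proof.
move=> i j ij; apply/eqP; apply: contraT => ne.
have := rf_al i; rewrite -ract_sgen ij ract_sgen /rf => /matrixP/(_ 0 i).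
rewrite !mxE !eqxx (negPf ne) mulr0 subr0 => /eqP; rewrite -subr_eq0 opprK.
by rewrite -mulr2n pnatr_eq0.
Qed.

(* s_i changes only the coordinate along al_i. *)
Lemma ract_simple w i j : pos (ract w (al i)) -> ~ pos (ract (sgen j * w)%g (al i)) ->
  ract w (al i) = al j.
Proof.
move=> p /not_pos_neg; rewrite ractM ract_sgen; set x := ract w (al i) in p * => n.
have xE : x = x 0 j *: al j.
  apply/rowP=> l; rewrite !mxE eqxx /=; have [->|lj] := eqVneq l j.
    by rewrite mulr1.
  rewrite mulr0; apply/le_anti; rewrite natr_ge0 // andbT -oppr_ge0.
  have := natr_ge0 (n l); rewrite /rf !mxE eqxx (negPf lj) /=.
  by rewrite mulr0 subr0.
(* The coefficient of al_j squares to 1 because the form is invariant; nonnegativity leaves only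
   1. *)
have : cform x x = 2 by rewrite cform_ract cform_alii.
rewrite xE cformZl cformZr cform_alii mulrA => h.
have {}h : x 0 j * x 0 j = 1 by apply: (@mulIf _ (2 : rat)); rewrite ?mul1r.
have := natr_ge0 (p j); move: h; rewrite -expr2 => /eqP.
rewrite sqrf_eq1 => /orP[/eqP-> _|/eqP-> //].
by rewrite scale1r.
Qed.

Lemma ract_conj w i x :
  ract (w * sgen i * w^-1)%g x = x - cform (ract w (al i)) x *: ract w (al i).
Proof.
rewrite !ractM ract_sgen /rf linearB linearZ /= ractVK.
by rewrite -(cform_ract w) ractVK.
Qed.

Lemma reflection_eq v w i j : ract v (al i) = ract w (al j) ->
  (v * sgen i * v^-1)%g = (w * sgen j * w^-1)%g.
Proof. by move=> h; apply: ract_inj => x; rewrite !ract_conj h. Qed.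

(** Equal reflections have proportional roots; both have norm 2, so the factor is 1 or -1, and
    positivity excludes -1. *)
Lemma reflection_root v w i j : (v * sgen i * v^-1)%g = (w * sgen j * w^-1)%g ->
  pos (ract v (al i)) -> pos (ract w (al j)) -> ract v (al i) = ract w (al j).
Proof.
move=> h; set x := ract v _; set y := ract w _ => px py.
have xx : cform x x = 2 by rewrite cform_ract cform_alii.
have yy : cform y y = 2 by rewrite cform_ract cform_alii.
have : x - cform x x *: x = x - cform y x *: y by rewrite -!ract_conj h.
move/addrI/oppr_inj; rewrite xx cformC; set c := cform x y => xc.
have xE : x = (c / 2) *: y.
  by apply: (@scalerI _ _ (2 : rat)) => //; rewrite xc scalerA mulrC mulfVK.
have c2 : (c / 2) ^+ 2 = 1.
  move: xx; rewrite xE cformZl cformZr yy mulrA -expr2 => h2.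
  by apply: (@mulIf _ (2 : rat)); rewrite ?mul1r.
move/eqP: c2; rewrite sqrf_eq1 => /orP[]/eqP c1; rewrite xE c1 ?scale1r //.
rewrite c1 scaleN1r in xE; have /eqP := ract_al_neq0 w j; case.
by apply: pos_oppF; rewrite // -/y -xE.
Qed.

Definition del n s := take n s ++ drop n.+1 s.

Lemma size_del n s : (n < size s)%N -> size (del n s) = (size s).-1.
Proof. by move=> ns; rewrite size_cat size_take ns size_drop; lia. Qed.

(** Let the letters of s act one by one, from the right. The letter s_j at which the root turns
    negative meets the simple root al_j, so the reflection is conjugate to s_j by the letters
    already applied, and multiplying by it cancels that letter. *)
Lemma root_exchange v i s :
  pos (ract v (al i)) -> ~ pos (ract (Wword s * v)%g (al i)) ->
  exists2 n, (n < size s)%N & (Wword s * (v * sgen i * v^-1))%g = Wword (del n s).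
Proof.
elim: s => [|j s IH] p; first by rewrite mul1g.
have [q n|q n] := pselect (pos (ract (Wword s * v)%g (al i))).
  exists 0%N => //; rewrite /del /= drop0 Wword_cons.
  rewrite Wword_cons -mulgA in n; have e := ract_simple q n.
  have : (Wword s * v * sgen i * (Wword s * v)^-1)%g = sgen j.
    by rewrite (@reflection_eq _ 1%g _ j) ?ract1 // invg1 mulg1 mul1g.
  rewrite invgM !mulgA => h.
  apply: (@mulIg _ (Wword s)^-1%g); rewrite mulgV -!mulgA.
  by rewrite -!mulgA in h; rewrite h sgenK.
have [n' n's e] := IH p q; exists n'.+1 => //.
by rewrite Wword_cons -mulgA e /del /= -Wword_cons.
Qed.

Lemma strong_exchange v i s (t : affsym k) : t = (v * sgen i * v^-1)%g ->
  (len (Wword s * t)%g < len (Wword s))%N ->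
  exists2 n, (n < size s)%N & (Wword s * t)%g = Wword (del n s).
Proof.
move=> tE h; wlog p : v tE / pos (ract v (al i)) => [H|].
  have [p|/not_pos_neg p] := pselect (pos (ract v (al i))); first exact: H tE p.
  apply: (H (v * sgen i)%g); last by rewrite ractM ract_sgen rf_al linearN.
  by rewrite tE invgM sgenV !mulgA sgenKr.
rewrite tE; apply: (@root_exchange v i s p) => q; move: h.
(* If s kept the root positive, s t would make it negative; deleting a letter from a reduced word r
   of s t would then give s, although s t is the shorter of the two. *)
have [r rE rr] := reduced_word (Wword s * t)%g.
have tt : (t * t)%g = 1%g by rewrite tE !mulgA mulgVK sgenKr mulgV.
move=> h.
have [|n nr] := @root_exchange v i r p.
  rewrite rE 2!ractM; have -> : ract t (ract v (al i)) = - ract v (al i).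
    by rewrite tE -ractM mulgVK ractM ract_sgen rf_al linearN.
  rewrite linearN /= -ractM => q'.
  by have /eqP := ract_al_neq0 (Wword s * v)%g i; apply; apply: pos_oppF.
rewrite -tE rE -mulgA tt mulg1 => sE.
have := len_Wword (del n r); rewrite -sE size_del // (eqP rr) rE; lia.
Qed.

End RootLattice.


(** * Reduced words and Matsumoto's theorem *)

Section Matsumoto.
Variable k : nat.
Implicit Types (v w : affsym k) (s t : seq 'I_k.+1) (i j : 'I_k.+1).

Lemma sgen_eql i v w : (sgen i * v)%g = w -> v = (sgen i * w)%g.
Proof. by move<-; rewrite sgenKl. Qed.

Lemma left_exchange j s : (len (sgen j * Wword s)%g < len (Wword s))%N ->
  exists2 n, (n < size s)%N & (sgen j * Wword s)%g = Wword (del n s).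
Proof.
have <- : (Wword s * ((Wword s)^-1 * sgen j * Wword s))%g = (sgen j * Wword s)%g.
  by rewrite -mulgA mulVKg.
by apply: (@strong_exchange _ (Wword s)^-1%g j); rewrite invgK.
Qed.

(** The letter exchanged for j cannot be the first one, since that would give s_j = s_i. So i
    survives right behind j. *)
Lemma left_exchange_cons i j s : i != j ->
  (len (sgen j * Wword (i :: s))%g < len (Wword (i :: s)))%N ->
  exists2 r, (size r).+1 = size s & Wword (j :: i :: r) = Wword (i :: s).
Proof.
move=> ij /left_exchange[[|n] /= ns e].
  rewrite /del /= drop0 Wword_cons mulgA in e.
  have /mulIg/mulIg/sgen_inj :
      (sgen j * sgen i * Wword s)%g = (sgen i * sgen i * Wword s)%g.
    by rewrite e sgenK mul1g.
  by move=> ji; rewrite ji eqxx in ij.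
exists (del n s); last first.
  by rewrite Wword_cons -[i :: del n s]/(del n.+1 (i :: s)) -e sgenKl.
by rewrite size_del //; case: s ns e.
Qed.

Lemma reduced_same s t : reduced s -> Wword s = Wword t -> size s = size t -> reduced t.
Proof. by rewrite /reduced => + <- <-. Qed.

Lemma reduced_size s t : reduced s -> reduced t -> Wword s = Wword t -> size s = size t.
Proof. by rewrite /reduced => /eqP -> /eqP -> ->. Qed.

(** Both descents would make the images of al_i and al_j under the inverse of w negative, whereas
    their sum is the fixed positive vector al_i + al_j. *)
Lemma not_two_left_descents w i j : k = 1%N -> i != j ->
  (len (sgen i * w)%g < len w)%N -> (len (sgen j * w)%g < len w)%N -> False.
Proof.
move=> k1 ij.
have E l : (sgen l * w)%g = ((w^-1 * sgen l)^-1)%g by rewrite invgM invgK sgenV.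
rewrite !E !len_inv -(len_inv w) => /neg_ract pi /neg_ract pj.
have := posD pi pj; rewrite -opprD -(linearD (ract _)) /= ract_pair // => n.
have /matrixP/(_ 0 i) := pos_oppF (posD (@pos_al k i) (@pos_al k j)) n.
by rewrite !mxE !eqxx (negPf ij) addr0 => /eqP; rewrite oner_eq0.
Qed.

Variable P : seq 'I_k.+1 -> seq 'I_k.+1 -> Prop.
Hypotheses (P_refl : forall s, P s s) (P_sym : forall s t, P s t -> P t s)
  (P_trans : forall s t r, P s t -> P t r -> P s r)
  (P_cons : forall i s t, P s t -> P (i :: s) (i :: t))
  (P_comm : forall i j s, ~~ adjacent i j -> P (i :: j :: s) (j :: i :: s))
  (P_braid : forall i j s, braided i j ->
     P (i :: j :: i :: s) (j :: i :: j :: s)).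

(** Two reduced words with distinct first letters i and j are joined through words beginning with i
    j and j i, or with i j i and j i j, obtained by exchange; equal first letters are cancelled. An
    arbitrary [P] lets the result serve both for products of generators and for the shape of
    words. *)
Lemma matsumoto s t : reduced s -> reduced t -> Wword s = Wword t -> P s t.
Proof.
have [n] := ubnP (size s); elim: n s t => // n IH [|i s] [|j t] sn rs rt st.
- exact: P_refl.
- by have := reduced_size rs rt st.
- by have := reduced_size rs rt st.
rewrite /= ltnS in sn.
have sz : size s = size t by case: (reduced_size rs rt st).
have rs' := @reduced_catr _ [:: i] s rs; have rt' := @reduced_catr _ [:: j] t rt.
have cancel l u u1 : Wword (l :: u) = Wword (l :: u1) -> Wword u = Wword u1 :> affsym k.
  by rewrite !Wword_cons => /mulgI.
have step l u u1 : (size u < n)%N -> reduced (l :: u) -> size u = size u1 ->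
    Wword (l :: u) = Wword (l :: u1) -> P (l :: u) (l :: u1).
  move=> un ru uv /cancel e; apply: P_cons; have ru' := @reduced_catr _ [:: l] u ru.
  exact: IH (reduced_same ru' e uv) e.
have [ij|ij] := eqVneq i j.
  by subst j; apply: step.
have desc l u : reduced (l :: u) ->
    (len (sgen l * Wword (l :: u))%g < len (Wword (l :: u)))%N.
  by rewrite reduced_cons Wword_cons sgenKl => /andP[].
have di := desc _ _ _ rs; have dj := desc _ _ _ rt; rewrite -st in dj.
have [r szr e] := left_exchange_cons ij dj.
have Pt : P (j :: i :: r) (j :: t).
  by apply/P_sym/step; rewrite ?e ?st //= -?sz.
have [ad|nadj] := boolP (adjacent i j); last first.
  apply: P_trans Pt; apply: P_trans (P_comm _ nadj); apply: step => //.
  by rewrite -e !Wword_cons !mulgA (sgen_comm nadj).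
have [k1|k1] := ltnP 1 k; last first.
  by have := not_two_left_descents (leq1_eq1 k1 ij) ij di dj.
have br : braided i j by rewrite /braided ad k1.
(* A second exchange, now of i against the word j i r. Deleting j leaves too short a word; deleting
   i would make s_i and s_j commute, and the braid relation would force s_i = s_j. So a letter of r
   goes. *)
have [r' szr' e'] : exists2 r', (size r').+1 = size r &
    Wword (i :: j :: i :: r') = Wword (i :: s).
  rewrite -e in di; have [[|[|m]] mr e2] := left_exchange di.
  - move/sgen_eql: e2; rewrite /del /= ?drop0 e => e2.
    have := len_Wword r; rewrite !Wword_cons sgenKl in e2.
    move: rs; rewrite /reduced Wword_cons e2 => /eqP <- /=.
    by rewrite -szr ltnNge leqnSn.
  - move/sgen_eql: e2; rewrite /del /= ?drop0 !Wword_cons !mulgA => /mulIg e2.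
    have := sgen_braid br; rewrite mulgA -e2 -mulgA sgenK mulg1 => /esym/sgen_eql.
    rewrite sgenK => /eqP; rewrite mulg_eq1 sgenV => /eqP/sgen_inj ji.
    by rewrite ji eqxx in ij.
  - exists (del m r); first by rewrite size_del //; case: (r) mr.
    by rewrite Wword_cons -e -[j :: i :: del m r]/(del m.+2 (j :: i :: r)) -e2 sgenKl.
have e'' : Wword (j :: i :: j :: r') = Wword (i :: s).
  by rewrite -e' !Wword_cons !mulgA -!(mulgA _ (sgen _) (sgen _)) (sgen_braid br).
apply: (@P_trans _ (i :: j :: i :: r')); first by apply: step => //=; rewrite szr'.
apply: P_trans (P_braid _ br) _.
apply: step; rewrite -?st //= ?szr' ?szr -?sz //.
by apply: reduced_same rs _ _; rewrite ?e'' //= szr' szr.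
Qed.

End Matsumoto.

(** * Products of generators under the nilCoxeter relations, and the twisted Leibniz rule *)

Section NilWords.
Variables (k : nat) (A : algType rat) (u : 'I_k.+1 -> A).
Hypotheses (u_sq : forall i, u i * u i = 0)
  (u_comm : forall i j, ~~ adjacent i j -> u i * u j = u j * u i)
  (u_braid : forall i j, braided i j -> u i * u j * u i = u j * u i * u j).
Implicit Types (v w : affsym k) (s t : seq 'I_k.+1) (i j : 'I_k.+1).
Implicit Types lam : {ffun 'I_k.+1 -> rat}.

Definition uprod s : A := \prod_(i <- s) u i.

Lemma uprod_cons i s : uprod (i :: s) = u i * uprod s.
Proof. exact: big_cons. Qed.

Lemma uprod_cat s t : uprod (s ++ t) = uprod s * uprod t.
Proof. exact: big_cat. Qed.

Lemma uprod_nil : uprod [::] = 1.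
Proof. exact: big_nil. Qed.

Lemma uprod_reduced s t : reduced s -> reduced t -> Wword s = Wword t ->
  uprod s = uprod t.
Proof.
apply: (@matsumoto _ (fun s t => uprod s = uprod t)) => //.
- by move=> ? ? ? -> ->.
- by move=> i r r' e; rewrite !uprod_cons e.
- by move=> i j r ij; rewrite !uprod_cons !mulrA u_comm.
- by move=> i j r ij; rewrite !uprod_cons !mulrA u_braid.
Qed.

Lemma nonreduced_cons i s : reduced s -> ~~ reduced (i :: s) ->
  exists2 r, Wword (i :: r) = Wword s & reduced (i :: r).
Proof.
move=> rs; rewrite reduced_cons rs /= -len_sgenl_ltn => ds.
have [r rE rr] := reduced_word (sgen i * Wword s)%g.
exists r; first by rewrite Wword_cons rE sgenKl.
by rewrite reduced_cons rr rE sgenKl.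
Qed.

(** At the first letter, from the right, that breaks reducedness, the reduced suffix can be
    rewritten to begin with the same letter, and u_i u_i = 0. *)
Lemma uprod_nonreduced s : ~~ reduced s -> uprod s = 0.
Proof.
elim: s => [|i s IH]; first by rewrite /reduced Wword_nil len1.
have [rs|/IH s0 _] := boolP (reduced s); last by rewrite uprod_cons s0 mulr0.
case/(nonreduced_cons rs) => r e rr.
by rewrite uprod_cons -(uprod_reduced rr rs e) uprod_cons mulrA u_sq mul0r.
Qed.

(* A weight is represented by its values lam j on the simple coroots al_j. *)
Definition wrefl i lam : {ffun 'I_k.+1 -> rat} :=
  [ffun j => lam j - lam i * cartan j i].

Definition wact s lam := foldr wrefl lam s.

Lemma wact_cat s t lam : wact (s ++ t) lam = wact s (wact t lam).
Proof. exact: foldr_cat. Qed.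

Lemma wreflE i lam : wrefl i lam i = - lam i.
Proof. by rewrite ffunE /cartan eqxx; ring. Qed.

Lemma wact_word s t lam : Wword s = Wword t -> wact s lam = wact t lam.
Proof.
have E r : wact r lam =
    foldr (fun i (y : {ffun 'I_k.+1 -> rat^o}) =>
             y - y i *: [ffun j => cartan j i : rat^o]) lam r.
  by elim: r => //= i r ->; apply/ffunP=> j; rewrite !ffunE.
rewrite !E => /WwordP; 
apply: (@foldr_refl_cong k _ (fun i (y : {ffun 'I_k.+1 -> rat^o}) => y i)
  (fun i => [ffun j => cartan j i : rat^o])) => [i c x y|i j]; by rewrite !ffunE.
Qed.

(* D_lam of the product of the word s, by the twisted Leibniz rule. *)
Fixpoint dprod lam s : A :=
  if s is i :: s' then wact s' lam i *: uprod s' + u i * dprod lam s' else 0.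

(** The weight seen by the letters of s has already been moved by t, whence the twist in the first
    term. *)
Lemma dprod_cat lam s t :
  dprod lam (s ++ t) = dprod (wact t lam) s * uprod t + uprod s * dprod lam t.
Proof.
elim: s => [|i s IH] /=; first by rewrite uprod_nil mul0r mul1r add0r.
rewrite IH uprod_cat wact_cat uprod_cons mulrDl mulrDr -!addrA -scalerAl.
by rewrite !mulrA.
Qed.

Lemma dprodE lam s : dprod lam s = \sum_(n < size s)
  wact (drop n.+1 s) lam (nth ord0 s n) *: uprod (del n s).
Proof.
elim: s => [|i s IH] /=; first by rewrite big_ord0.
rewrite big_ord_recl /= drop0 /del /= drop0; congr (_ + _).
rewrite IH mulr_sumr; apply: eq_bigr => n _.
by rewrite -scalerAr -uprod_cons.
Qed.

(** When the head i meets a reduced word beginning with i, the two terms deleting one copy of i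
    cancel, as s_i negates the value at al_i; the other terms contain u_i u_i. The hypothesis is met
    in [down_uprod], where [dprod] agrees with D on reduced words. *)
Lemma dprod_nonreduced lam : (forall s t, reduced s -> reduced t ->
    Wword s = Wword t -> dprod lam s = dprod lam t) ->
  forall s, ~~ reduced s -> dprod lam s = 0.
Proof.
move=> dred; elim=> [|i s IH]; first by rewrite /reduced Wword_nil len1.
have [rs|ns _] := boolP (reduced s); last first.
  by rewrite /= IH // uprod_nonreduced // mulr0 scaler0 addr0.
case/(nonreduced_cons rs) => r e rr.
rewrite /= -(dred _ _ rr rs e) -(wact_word _ e) -(uprod_reduced rr rs e) /=.
rewrite wreflE uprod_cons mulrDr mulrA u_sq mul0r addr0 -scalerAr -scalerDl.
by rewrite addNr scale0r.
Qed.

End NilWords.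


(** * Bruhat covers as deletions of letters from a reduced word *)

Section Covers.
Variables (k : nat) (R : root_datum k).
Local Notation h := (cartan_space R).
Local Notation hdual := 'Hom(h, rat^o).
Local Notation V := 'rV[rat]_k.+1.
Implicit Types (v w : affsym k) (s t : seq 'I_k.+1) (i j : 'I_k.+1).
Implicit Types (x y : V) (lam : {ffun 'I_k.+1 -> rat}) (Lambda : hdual).

Lemma cform_alr x i : cform x (al i) = \sum_j x 0 j * cartan j i.
Proof.
rewrite /cform trmx_delta -colE !mxE; apply: eq_bigr => j _; by rewrite !mxE.
Qed.

(** Together with [root_comb], this realizes the lattice in h and in its dual, equivariantly for
    W. *)
Definition coroot_comb x : h := \sum_j x 0 j *: coroot R j.
Definition root_comb x : hdual := \sum_j x 0 j *: root R j.

Lemma coroot_comb_al i : coroot_comb (al i) = coroot R i.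
Proof.
rewrite /coroot_comb (bigD1 i) //= mxE !eqxx scale1r big1 ?addr0 // => j ji.
by rewrite mxE eqxx (negPf ji) scale0r.
Qed.

Lemma root_comb_al i : root_comb (al i) = root R i.
Proof.
rewrite /root_comb (bigD1 i) //= mxE !eqxx scale1r big1 ?addr0 // => j ji.
by rewrite mxE eqxx (negPf ji) scale0r.
Qed.

Lemma coroot_combB c x y :
  coroot_comb (x - c *: y) = coroot_comb x - c *: coroot_comb y.
Proof.
rewrite /coroot_comb scaler_sumr -sumrB; apply: eq_bigr => j _.
by rewrite !mxE scalerBl scalerA.
Qed.

Lemma root_combB c x y : root_comb (x - c *: y) = root_comb x - c *: root_comb y.
Proof.
rewrite /root_comb scaler_sumr -sumrB; apply: eq_bigr => j _.
by rewrite !mxE scalerBl scalerA.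
Qed.

Lemma pairing_coroot_comb x Lambda :
  pairing (coroot_comb x) Lambda = \sum_j x 0 j * pairing (coroot R j) Lambda.
Proof.
by rewrite /pairing linear_sum; apply: eq_bigr => j _; rewrite linearZ.
Qed.

Lemma pairing_root_comb x i : pairing (coroot R i) (root_comb x) = cform x (al i).
Proof.
rewrite /pairing /root_comb sum_lfunE cform_alr; apply: eq_bigr => j _.
by rewrite lfunE /= root_coroot cartanC.
Qed.

Lemma act_h_comb w x : act_h w (coroot_comb x) = coroot_comb (ract w x).
Proof.
have [s <- _] := ex_reduced w; rewrite act_h_word ract_word.
elim: s => //= i s ->; rewrite /refl_h /rf coroot_combB coroot_comb_al.
rewrite pairing_coroot_comb cformC cform_alr; congr (_ - _ *: _).
by apply: eq_bigr => j _; rewrite /pairing root_coroot.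
Qed.

Lemma act_hdual_comb w x : act_hdual w (root_comb x) = root_comb (ract w x).
Proof.
have [s <- _] := ex_reduced w; rewrite act_hdual_word ract_word.
elim: s => //= i s ->; rewrite /refl_hdual /rf root_combB root_comb_al.
by rewrite pairing_root_comb cformC.
Qed.

(** Independence of the simple roots enters here; it allows positivity to be read off the
    coordinates. *)
Lemma root_comb_inj : injective root_comb.
Proof.
move=> x y xy; have /freeP fr : free (map_tuple (root R) (ord_tuple k.+1)).
  by have := root_free R; rewrite codomE -val_ord_tuple.
apply/rowP=> j; apply/eqP; rewrite -subr_eq0; apply/eqP.
apply: (fr (fun j => x 0 j - y 0 j)).
under eq_bigr => l _ do rewrite -tnth_nth tnth_map tnth_ord_tuple scalerBl.
by rewrite sumrB -/(root_comb x) -/(root_comb y) xy subrr.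
Qed.

Lemma positive_rootP x : positive_root (root_comb x) <-> pos x.
Proof.
split=> [[c e] j|px].
  have -> : x = \row_j (c j)%:R.
    apply: root_comb_inj; rewrite e; apply: eq_bigr => l _; by rewrite mxE.
  by rewrite mxE natr_nat.
exists (fun j => Num.truncn (x 0 j)); apply: eq_bigr => j _.
by rewrite truncnK.
Qed.

(** The actions on coroots and on weights are adjoint to each other. *)
Lemma sum_wact t lam x :
  \sum_j ract (Wword t)^-1%g x 0 j * lam j = \sum_j x 0 j * wact t lam j.
Proof.
elim: t x => [|i t IH] x /=; first by rewrite Wword_nil invg1 ract1.
rewrite Wword_cons invgM sgenV ractM IH ract_sgen; set m := wact t lam.
rewrite /rf; have := cform_alr x i; rewrite cformC; move: (cform _ _) => c cE.
transitivity (\sum_j (x 0 j * m j - c * (j == i)%:R * m j)).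
  by apply: eq_bigr => j _; rewrite -mulrBl !mxE eqxx.
under [RHS]eq_bigr => j _ do rewrite ffunE mulrBr.
rewrite !sumrB; congr (_ - _); rewrite (bigD1 i) //= eqxx mulr1 big1 ?addr0.
  by rewrite cE mulr_suml; apply: eq_bigr => j _; ring.
by move=> j /negPf ->; rewrite mulr0 mul0r.
Qed.

Definition weight Lambda : {ffun 'I_k.+1 -> rat} :=
  [ffun j => pairing (coroot R j) Lambda].

Lemma pairing_wact t Lambda i :
  pairing (act_h (Wword t)^-1%g (coroot R i)) Lambda = wact t (weight Lambda) i.
Proof.
rewrite -coroot_comb_al act_h_comb pairing_coroot_comb.
transitivity (\sum_j ract (Wword t)^-1%g (al i) 0 j * weight Lambda j).
  by apply: eq_bigr => j _; rewrite ffunE.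
rewrite sum_wact (bigD1 i) //= mxE !eqxx mul1r big1 ?addr0 // => j ji.
by rewrite mxE eqxx (negPf ji) mul0r.
Qed.

(** A reflection has a single positive root, so [xget] has only one value to choose. *)
Lemma cover_coroot_eq v w u i : (v^-1 * w)%g = (u * sgen i * u^-1)%g ->
  pos (ract u (al i)) -> cover_coroot R v w = act_h u (coroot R i).
Proof.
move=> e p; apply: xget_unique.
  exists u, i; split=> //.
  by rewrite -root_comb_al act_hdual_comb; apply/positive_rootP.
move=> _ [u' [i' [e' + ->]]].
rewrite -root_comb_al act_hdual_comb => /positive_rootP p'.
by rewrite -!coroot_comb_al !act_h_comb (reflection_root _ p p') // -e.
Qed.

Lemma Wword_del n s : (n < size s)%N -> ((Wword (del n s))^-1 * Wword s)%g =
  ((Wword (drop n.+1 s))^-1 * sgen (nth ord0 s n) * Wword (drop n.+1 s))%g.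
Proof.
move=> ns; rewrite -[in Wword s](cat_take_drop n s) (drop_nth ord0) //.
by rewrite /del !Wword_cat Wword_cons invgM -!mulgA mulKg.
Qed.

Lemma bruhat_lt_len v w : bruhat_lt v w -> (len v < len w)%N.
Proof. by elim=> // a b c _ ab _ bc; apply: ltn_trans bc. Qed.

(** From left to right this is the strong exchange condition; conversely a deletion is
    multiplication by the reflection of [Wword_del]. *)
Lemma bruhat_coverP s v : reduced s -> bruhat_cover v (Wword s) <->
  exists n, [/\ (n < size s)%N, reduced (del n s) & v = Wword (del n s)].
Proof.
move=> rs; split=> [[vw lw]|[n [ns rd ->]]]; last first.
  have lw : len (Wword s) = (len (Wword (del n s))).+1.
    by rewrite -(eqP rs) -(eqP rd) size_del // prednK //; apply: leq_ltn_trans ns.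
  split=> //; rewrite -[Wword s](mulVKg (Wword (del n s))).
  apply: BruhatStep; last by rewrite mulVKg lw.
  by exists (Wword (drop n.+1 s))^-1%g, (nth ord0 s n); rewrite invgK Wword_del.
have [u [i e]] : reflection (v^-1 * Wword s)%g.
  (* A composite step raises the length by at least two, so a cover is a single reflection. *)
  case: vw lw => {s rs} [{}v t [u [i ->]] _ _|a b c ab bc lc].
    by exists u, i; rewrite mulKg.
  have := bruhat_lt_len ab; have := bruhat_lt_len bc.
  by rewrite lc ltnS leqNgt => /negPf->.
have ve : v = (Wword s * (u * sgen i * u^-1))%g.
  have tt : (v^-1 * Wword s * (v^-1 * Wword s))%g = 1%g.
    by rewrite e !mulgA mulgVK sgenKr mulgV.
  by rewrite -e -[X in (X * _)%g](mulVKg v) -mulgA tt mulg1.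
have [|n ns e'] := @strong_exchange _ u i s _ (erefl _); first by rewrite -ve lw.
exists n; split=> //; last by rewrite ve.
by rewrite /reduced size_del // -e' -ve (eqP rs) lw.
Qed.

(** If deleting either of two letters gave the same element, deleting both would leave the element
    of s unchanged, against reducedness. *)
Lemma del_inj s n m : reduced s -> (n < size s)%N -> (m < size s)%N ->
  Wword (del n s) = Wword (del m s) -> n = m.
Proof.
move=> rs; wlog: n m / (n <= m)%N => [H ns ms e|].
  by case/orP: (leq_total n m) => h; [|apply/esym]; apply: H.
rewrite leq_eqVlt => /orP[/eqP -> //|nm] ns ms e; exfalso.
pose a := take n s; pose b := take (m - n.+1) (drop n.+1 s); pose c := drop m.+1 s.
pose i := nth ord0 s n; pose j := nth ord0 s m.
have dE : drop n.+1 s = b ++ j :: c.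
  rewrite -[LHS](cat_take_drop (m - n.+1)) drop_drop subnK //.
  by rewrite (drop_nth ord0 ms).
have sE : s = a ++ i :: b ++ j :: c.
  by rewrite -[LHS](cat_take_drop n) (drop_nth ord0) // dE.
have e1 : del n s = a ++ b ++ j :: c by rewrite /del dE.
have e2 : del m s = a ++ i :: b ++ c.
  rewrite /del -/c; have -> : take m s = a ++ i :: b.
    rewrite -(cat_take_drop n.+1 (take m s)) take_takel // (take_nth ord0) //.
    rewrite -cats1 -catA /=.
    by congr (_ ++ _ :: _); rewrite /b take_drop subnK.
  by rewrite -catA.
move: e; rewrite e1 e2 !(Wword_cat, Wword_cons) => /mulgI; rewrite !mulgA => /mulIg e.
have := rs; rewrite /reduced sE !(Wword_cat, Wword_cons) (mulgA (Wword b)) e.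
rewrite !mulgA sgenKr => /eqP hl; have := len_Wword (a ++ b ++ c).
by rewrite !Wword_cat mulgA -hl !size_cat /= !size_cat /=; lia.
Qed.

Lemma sum_covers (M : lmodType rat) (F : affsym k -> M) s Lambda : reduced s ->
  \sum_(v \in [set v | bruhat_cover v (Wword s)])
     pairing (cover_coroot R v (Wword s)) Lambda *: F v =
  \sum_(n < size s | reduced (del n s))
     wact (drop n.+1 s) (weight Lambda) (nth ord0 s n) *: F (Wword (del n s)).
Proof.
move=> rs; pose r := [seq Wword (del n s) |
  n : 'I_(size s) <- enum 'I_(size s) & reduced (del n s)].
have rP v : v \in r <-> bruhat_cover v (Wword s).
  rewrite bruhat_coverP //; split=> [/mapP[n]|[n [ns rd ->]]].
    by rewrite mem_filter => /andP[rd _] ->; exists n.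
  by apply/mapP; exists (Ordinal ns); rewrite // mem_filter /= rd mem_enum.
rewrite (@fsbigE _ _ _ _ _ r).
- rewrite big_mkcond big_map big_filter big_enum_cond /=; apply: eq_bigr => n rd.
  rewrite mem_set /=; last by apply/rP/map_f; rewrite mem_filter rd mem_enum.
  congr (_ *: _); rewrite -pairing_wact; congr pairing.
  apply: cover_coroot_eq; first by rewrite invgK Wword_del.
  (* The suffix from position n is reduced, so the root attached to its first letter is positive;
     this fixes the sign of the coroot. *)
  apply: pos_ract; have rd' : reduced (nth ord0 s n :: drop n.+1 s).
    by rewrite -drop_nth //; apply: (@reduced_catr _ (take n s)); rewrite cat_take_drop.
  move: rd'; rewrite reduced_cons => /andP[_].
  by rewrite -{2}sgenV -invgM !len_inv.
- rewrite map_inj_in_uniq; first by apply/filter_uniq/enum_uniq.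
  by move=> n m _ _ e; apply: val_inj; exact: del_inj rs (ltn_ord n) (ltn_ord m) e.
- by move=> v /= /rP.
- by move=> v /rP vr; rewrite vr.
Qed.

End Covers.


(** * Cyclically decreasing words *)

Section CyclicWords.
Variable k : nat.
Implicit Types (v w : affsym k) (s t : seq 'I_k.+1) (i j a : 'I_k.+1).
Implicit Types (S T : {set 'I_k.+1}).

(* For a word without repetition the second condition says that i + 1 never
   occurs after i. *)
Definition decr s := uniq s && pairwise (fun i j => j != ordS i) s.

Lemma ract_notin s i x : i \notin s -> ract (Wword s) x 0 i = x 0 i.
Proof.
rewrite ract_word; elim: s => //= j s IH; rewrite inE negb_or => /andP[ij /IH <-].
by rewrite /rf !mxE eqxx (negPf ij) /= mulr0 subr0.
Qed.

(** Letters other than i leave the i-th coordinate alone, so the inverse of [Wword s] sends al_i to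
    a root with coordinate 1 there. That root is positive, hence i lengthens s. *)
Lemma uniq_reduced s : uniq s -> reduced s.
Proof.
elim: s => [_|i s IH /= /andP[ni us]]; first by rewrite /reduced Wword_nil len1.
rewrite reduced_cons IH //= -(len_inv (Wword s)) -(len_inv (sgen i * _)%g).
rewrite invgM sgenV; apply/posP; apply: contrapT => /not_pos_neg.
move/(_ i); rewrite mxE -Wword_rev ract_notin ?mem_rev // !mxE !eqxx.
by move/natr_ge0; rewrite oppr_ge0 lt_geF.
Qed.

Lemma Wword_pull a s t : {in s, forall b, ~~ adjacent a b} ->
  Wword (s ++ a :: t) = Wword (a :: s ++ t).
Proof.
elim: s => //= b s IH h; rewrite Wword_cons IH => [|c cs].
  by rewrite !Wword_cons !mulgA sgen_comm // adjacentC h ?mem_head.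
by apply: h; rewrite inE cs orbT.
Qed.

(** The head a of s can be pulled to the front of t: a letter before a in t is not a - 1 by the
    order in t, nor a + 1 by the order in s, so it commutes with a. *)
Lemma decr_unique s t : decr s -> decr t -> s =i t -> Wword s = Wword t.
Proof.
elim: s t => [|a s IH] t.
  by case: t => // b t _ _ /(_ b); rewrite mem_head.
rewrite /decr /= => /andP[/andP[nas us] /andP[las ps]].
move=> /andP[ut pt] e; have : a \in t by rewrite -e mem_head.
move=> at_; case: (path.splitPr at_) ut pt e => t1 t2 ut pt e {at_}.
move: ut pt; rewrite cat_uniq pairwise_cat /= negb_or.
case/and4P=> u1 /andP[na1 h12] na2 u2.
rewrite allrel_consr => /and4P[/andP[l1 l12] p1 l2 p2].
have eq12 : s =i t1 ++ t2.
  move=> b; have := e b; rewrite !mem_cat !inE.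
  have [->|_] //= := eqVneq b a.
  by rewrite (negPf nas) (negPf na1) (negPf na2).
rewrite Wword_pull => [|b b1].
  rewrite !Wword_cons; congr (_ * _)%g; apply: IH => //.
    by rewrite /decr us.
  by rewrite /decr cat_uniq pairwise_cat u1 u2 h12 l12 p1 p2.
rewrite /adjacent negb_or (allP l1) //= (allP las) // eq12 mem_cat.
by rewrite b1.
Qed.

Definition decr_on S s := decr s /\ s =i S.

Lemma decr_on_swap S p s i j : ~~ adjacent i j ->
  decr_on S (p ++ i :: j :: s) -> decr_on S (p ++ j :: i :: s).
Proof.
move=> nij [d e]; split; last first.
  by move=> x; rewrite -e !mem_cat !inE; congr orb; exact: orbCA.
move: d; rewrite /decr => /andP[u d]; apply/andP; split.
  rewrite (perm_uniq (s2 := p ++ i :: j :: s)) // perm_cat2l.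
  by apply/permP=> q /=; lia.
move: d; rewrite !pairwise_cat !allrel_consr /=.
move: nij; rewrite /adjacent negb_or => /andP[h1 h2].
by case/and3P=> /and3P[-> -> ->] -> /and3P[/andP[_ ->] -> ->]; rewrite h1.
Qed.

(** Commutations preserve the order condition, and a braid move never applies to a word without
    repetition. *)
Lemma decr_on_reduced S s t : reduced s -> reduced t -> Wword s = Wword t ->
  decr_on S s -> decr_on S t.
Proof.
move=> rs rt st.
(* The prefix p makes the property stable under adding a letter in front. *)
suff /(_ [::]) : forall p, decr_on S (p ++ s) <-> decr_on S (p ++ t) by case.
move: s t rs rt st; apply: matsumoto => //.
- by move=> s t h p; rewrite h.
- by move=> s t r h1 h2 p; rewrite h1.
- by move=> i s t h p; rewrite -!cat_rcons.
- by move=> i j s ij p; split; apply: decr_on_swap; rewrite // adjacentC.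
- have F i j s p : ~ decr_on S (p ++ i :: j :: i :: s).
    by case=> /andP[]; rewrite cat_uniq /= !inE eqxx orbT !andbF.
  by move=> i j s ij p; split=> /F.
Qed.

Lemma ordS_neq i : (0 < k)%N -> ordS i != i.
Proof.
move=> k0; rewrite -val_eqE /=; have := ltn_ord i; rewrite ltnS leq_eqVlt.
case/orP=> [/eqP->|ik]; first by rewrite modnn; case: (k) k0.
by rewrite modn_small // gtn_eqF.
Qed.

(** One word speaks for all reduced words by [decr_on_reduced]; [0 < k] makes j and j + 1 distinct
    letters. *)
Lemma cyc_decreasingP S w : (0 < k)%N ->
  cyc_decreasing S w <-> exists2 s, Wword s = w & decr_on S s.
Proof.
move=> k0; split=> [h|[s <- ds] t /andP[/eqP et /eqP szt]].
  have [s sw rs] := reduced_word w; exists s => //.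
  have [|us sS ds] := h s; first by rewrite /redword_of sw eqxx (eqP rs) sw /=.
  split=> //; rewrite /decr us; apply/(pairwiseP ord0) => p q; rewrite !inE => ps qs pq.
  apply/negP=> /eqP e; have := ds (nth ord0 s p).
  by rewrite -e -!sS !mem_nth // !index_uniq // ltnNge (ltnW pq) => /(_ isT isT).
have us : uniq s by case: ds => /andP[].
have [/andP[ut pt] tS] : decr_on S t.
  apply: decr_on_reduced ds => //; first exact: uniq_reduced.
  by rewrite /reduced szt et.
split=> // j; rewrite -!tS => jt Sjt; rewrite ltnNge leq_eqVlt.
apply/negP => /orP[/eqP e|lt].
  by have h := index_inj ord0 jt Sjt e; have := ordS_neq j k0; rewrite -h eqxx.
have /(pairwiseP ord0)/(_ _ _ _ _ lt) := pt.
by rewrite !nth_index // !inE !index_mem jt Sjt eqxx => /(_ isT isT).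
Qed.

Lemma wSE S s : (0 < k)%N -> decr_on S s -> wS S = Wword s.
Proof.
move=> k0 ds; apply: xget_unique; first by apply/cyc_decreasingP => //; exists s.
move=> w /cyc_decreasingP -/(_ k0)[t <- [dt tS]]; case: ds => ds sS.
by apply: decr_unique => // x; rewrite tS sS.
Qed.

Local Notation "a +' r" := (iter r (@ordS k.+1) a) (at level 50).

Lemma val_iter_ordS a r : val (a +' r) = ((a + r) %% k.+1)%N.
Proof.
elim: r => [|r IH] /=; first by rewrite addn0 modn_small.
by rewrite IH -[X in (X %% _)%N = _]addn1 modnDml addn1 addnS.
Qed.

Lemma iter_ordS_eq a p q : (a +' p == a +' q) = (p == q %[mod k.+1])%N.
Proof. by rewrite -val_eqE !val_iter_ordS eqn_modDl. Qed.

Lemma iter_ordS_inj a p q : (p <= k)%N -> (q <= k)%N -> a +' p = a +' q -> p = q.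
Proof. by move=> pk qk /eqP; rewrite iter_ordS_eq !modn_small // => /eqP. Qed.

Lemma ex_iter_ordS a i : exists2 r, (r <= k)%N & i = a +' r.
Proof.
exists ((i + k.+1 - a) %% k.+1)%N; first by rewrite -ltnS ltn_mod.
apply/val_inj; rewrite val_iter_ordS modnDmr subnKC.
  by rewrite modnDr modn_small.
by rewrite (leq_trans (ltnW (ltn_ord a))) // leq_addl.
Qed.

(** The arc a + r, ..., a + 1 read downwards; it stops short of a, where the circle is cut. *)
Fixpoint desc a r := if r is r'.+1 then a +' r :: desc a r' else [::].

Lemma mem_descP a r i :
  reflect (exists2 q, (0 < q <= r)%N & i = a +' q) (i \in desc a r).
Proof.
elim: r i => [|r IH] i; first by constructor; case=> q; lia.
rewrite [desc _ _]/= inE; apply: (iffP orP) => [[/eqP->|/IH[q qr ->]]|[q qr ->]].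
- by exists r.+1; rewrite ?leqnn.
- by exists q => //; lia.
- have [->|qr'] := eqVneq q r.+1; first by left.
  by right; apply/IH; exists q => //; lia.
Qed.

Lemma decr_desc a r : (r <= k)%N -> decr (desc a r).
Proof.
elim: r => //= r IH rk; have /andP[u p] := IH (ltnW rk).
rewrite /decr /= u p !andbT; apply/andP; split.
  apply/negP=> /mem_descP[q qr]; rewrite -iterS => /iter_ordS_inj; lia.
apply/allP=> _ /mem_descP[q qr ->]; rewrite -!iterS iter_ordS_eq.
rewrite (modn_small (_ : q < _)%N); last by lia.
(* Beyond a + k the circle returns to a, which is not in the arc. *)
have [->|rk'] := eqVneq r.+2 k.+1; first by rewrite modnn; lia.
by rewrite modn_small; lia.
Qed.

Lemma desc_split a p r : (r <= p)%N -> exists t, desc a p = t ++ desc a r.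
Proof.
elim: p => [|p IH]; first by case: r => //; exists [::].
rewrite leq_eqVlt => /orP[/eqP->|/IH[t e]]; first by exists [::].
by exists (a +' p.+1 :: t); rewrite /= e.
Qed.

Lemma mem_desc a i : (i \in desc a k) = (i != a).
Proof.
apply/mem_descP/idP => [[q qk ->]|ia].
  apply/negP=> /eqP/(@iter_ordS_inj a q 0); lia.
have [r rk e] := ex_iter_ordS a i; exists r => //; rewrite rk andbT lt0n.
by apply: contraNneq ia => r0; rewrite e r0.
Qed.

(** Cutting the circle at a point a outside S turns the cyclic order into a linear one. *)
Definition cword a S := [seq i <- desc a k | i \in S].

Lemma cword_decr_on a S : a \notin S -> decr_on S (cword a S).
Proof.
move=> aS; have /andP[u p] := @decr_desc a k (leqnn k); split.
  by rewrite /decr filter_uniq //= pairwise_filter.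
move=> i; rewrite mem_filter mem_desc andbC; case: eqVneq => // ->.
by rewrite (negPf aS).
Qed.

(* Meaningful for a proper subset T only. *)
Definition next_out T j :=
  j +' find (fun i => i \notin T) (traject (@ordS k.+1) j k.+1).

Lemma next_out_dist T j d : (d <= k)%N -> (forall e, (e < d)%N -> j +' e \in T) ->
  j +' d \notin T -> find (fun i => i \notin T) (traject (@ordS k.+1) j k.+1) = d.
Proof.
move=> dk h dT; set p := (fun i => _); have sz := size_traject (@ordS k.+1) j k.+1.
have hs : has p (traject (@ordS k.+1) j k.+1).
  by apply/hasP; exists (j +' d) => //; apply/trajectP; exists d.
have := nth_find j hs; have := hs; rewrite has_find sz => fk.
rewrite nth_traject // => pf.
have bf := @before_find _ j p (traject (@ordS k.+1) j k.+1).
move: (find p _) fk pf bf => f fk pf bf; case: (ltngtP f d) => // lt.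
  by move: pf; rewrite /p h.
by have := bf d lt; rewrite nth_traject /p ?dT // ltnS.
Qed.

Lemma next_out_spec T a j : a \notin T -> exists d, [/\ (d <= k)%N,
  next_out T j = j +' d, (forall e, (e < d)%N -> j +' e \in T) & j +' d \notin T].
Proof.
move=> aT; have [r rk e] := ex_iter_ordS j a; subst a.
have ex : exists r, (j +' r \notin T) by exists r.
pose d := ex_minn ex; exists d; rewrite /d.
case: ex_minnP => m mT mmin; have mr := mmin _ aT.
have mT' e : (e < m)%N -> j +' e \in T.
  by move=> em; apply: contraLR em => /mmin; rewrite -leqNgt.
split; rewrite ?(leq_trans mr) // /next_out (@next_out_dist _ _ m) //.
exact: leq_trans rk.
Qed.

(** As a lies outside T, the walk from a + q cannot pass beyond a, so the cyclic condition becomes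
    one on an interval of integers; for q = 0 the walk stops at once. *)
Lemma next_outP T a r q : a \notin T -> (0 < r <= k)%N -> (q <= k)%N ->
  a +' r \notin T -> (next_out T (a +' q) == a +' r) =
  (0 < q <= r)%N && all (fun e => a +' e \in T) (index_iota q r).
Proof.
move=> aT rk qk rT; apply/eqP/andP => [e|[q0 /allP h]].
  have [d [dk ne dT ndT]] := next_out_spec (a +' q) aT; rewrite ne in e.
  rewrite -iterD in e ndT.
  have {}dT f : (f < d)%N -> a +' (q + f) \in T by rewrite addnC iterD; apply: dT.
  have a0 : a +' k.+1 = a by apply/eqP; rewrite (iter_ordS_eq a _ 0) modnn mod0n.
  have q0 : (0 < q)%N.
    rewrite lt0n; apply/eqP => q0; subst q; rewrite addn0 in e ndT.
    have d0 : d = 0%N by case: (d) dT => // d' /(_ 0%N isT); rewrite /= (negPf aT).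
    by move: e; rewrite d0 => /(@iter_ordS_inj a 0); lia.
  have [dq|dq] := leqP (d + q) k.
    have {}e : (d + q = r)%N by apply: (@iter_ordS_inj a) => //; lia.
    split; first by lia.
    apply/allP=> f; rewrite mem_index_iota => /andP[qf fr].
    by rewrite -(subnKC qf) dT //; lia.
  (* A walk that wraps around would stop at a, which is not a + r. *)
  have : (k.+1 - q <= d)%N by lia.
  rewrite leq_eqVlt => /orP[/eqP f|/dT]; last first.
    by rewrite subnKC ?a0 ?(negPf aT) //; lia.
  have dq' : (d + q = k.+1)%N by lia.
  by move: e; rewrite dq' a0 => /(@iter_ordS_inj a 0 r); lia.
rewrite /next_out (@next_out_dist _ _ (r - q)); first by rewrite -iterD subnK //; lia.
- by lia.
- by move=> e er; rewrite -iterD; apply: h; rewrite mem_index_iota; lia.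
- by rewrite -iterD subnK //; lia.
Qed.

End CyclicWords.


(** * Coefficients of the deletions, and the level of a weight *)

Section Coefficients.
Variable k : nat.
Implicit Types (s t : seq 'I_k.+1) (i j a : 'I_k.+1) (S T : {set 'I_k.+1}).
Implicit Types lam : {ffun 'I_k.+1 -> rat}.
Local Notation "a +' r" := (iter r (@ordS k.+1) a) (at level 50).

Lemma wact_nonadj s lam j : {in s, forall b, ~~ adjacent j b /\ j != b} ->
  wact s lam j = lam j.
Proof.
elim: s => //= b s IH h.
rewrite ffunE IH => [|c cs]; last by apply: h; rewrite inE cs orbT.
have [hb1 hb2] := h b (mem_head _ _).
by rewrite cartan_nadj // mulr0 subr0.
Qed.

Lemma all_iotaSr (p : pred nat) q r : (q <= r)%N ->
  all p (index_iota q r.+1) = all p (index_iota q r) && p r.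
Proof.
move=> qr; rewrite /index_iota subSn // -addn1 iotaD all_cat /= andbT.
by rewrite subnKC.
Qed.

(** Only the reflection at the neighbour a + r can change the value at a + r + 1, with Cartan
    integer -1. If a + r is in S its own accumulated value is added; otherwise the sum stops
    there. *)
Lemma wact_desc a r lam S : (r < k)%N ->
  wact [seq j <- desc a r | j \in S] lam (a +' r.+1) =
  \sum_(1 <= q < r.+2 | all (fun e => a +' e \in S) (index_iota q r.+1)) lam (a +' q).
Proof.
elim: r => [|r IH] rk; first by rewrite /= big_ltn_cond //= big_geq // addr0.
have i0 : index_iota r.+2 r.+2 = [::] by rewrite /index_iota subnn.
rewrite big_mkcond big_nat_recr // i0 [all _ [::]]/=.
have far : wact [seq j <- desc a r | j \in S] lam (a +' r.+2) = lam (a +' r.+2).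
  apply: wact_nonadj => b; rewrite mem_filter => /andP[_ /mem_descP[q qr ->]].
  rewrite /adjacent negb_or -!iterS !iter_ordS_eq.
  rewrite !(modn_small (_ : r.+2 < k.+1)%N) //.
  rewrite !(modn_small (_ : q < k.+1)%N); last by lia.
  rewrite (modn_small (_ : q.+1 < k.+1)%N); last by lia.
  have [->|rk'] := eqVneq r.+3 k.+1; first by rewrite modnn; lia.
  by rewrite modn_small; lia.
have E : \sum_(1 <= q < r.+2) (if all (fun e => a +' e \in S) (index_iota q r.+2)
      then lam (a +' q) else 0) =
    if a +' r.+1 \in S then wact [seq j <- desc a r | j \in S] lam (a +' r.+1) else 0.
  case: ifP => h.
    rewrite IH ?(ltnW rk) // [RHS]big_mkcond /=; apply: eq_big_nat => q /andP[_ qr].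
    by rewrite all_iotaSr // h andbT.
  rewrite big_nat_cond big1 // => q /andP[/andP[_ qr] _].
  by rewrite all_iotaSr // h andbF.
transitivity ((if a +' r.+1 \in S
    then wact [seq j <- desc a r | j \in S] lam (a +' r.+1) else 0)
    + lam (a +' r.+2)); last by rewrite -E.
have -> : [seq j <- desc a r.+1 | j \in S] = if a +' r.+1 \in S
    then a +' r.+1 :: [seq j <- desc a r | j \in S]
    else [seq j <- desc a r | j \in S] by [].
case: ifP => h; last by rewrite far add0r.
rewrite [wact _ _]/= ffunE far (cartan_braided (i := a +' r.+2)); last first.
  by rewrite /braided /adjacent eqxx (leq_ltn_trans _ rk).
by ring.
Qed.

(* For i outside T, the sum of lam over the interval j, ..., i whose elements other
   than i lie in T. *)
Definition gap_weight lam T i := \sum_(j | next_out T j == i) lam j.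

(** The right-hand side is the coefficient with which a + r is deleted from [cword a S]; the
    left-hand side no longer mentions where the circle was cut. *)
Lemma gap_weightE a r lam S : (0 < r <= k)%N -> a \notin S ->
  gap_weight lam (S :\ (a +' r)) (a +' r) =
  wact [seq j <- desc a r.-1 | j \in S] lam (a +' r).
Proof.
case: r => // r rk aS; rewrite wact_desc // /gap_weight.
set T := S :\ _; have aT : a \notin T by rewrite !inE negb_and aS orbT.
have rT : a +' r.+1 \notin T by rewrite !inE eqxx.
have inj : injective (fun q : 'I_k.+1 => a +' q).
  by move=> p q /iter_ordS_inj e; apply/val_inj/e; rewrite -ltnS.
rewrite (reindex_inj inj).
rewrite [RHS](@big_nat_widenl _ _ _ 1 0) // (@big_nat_widen _ _ _ _ _ k.+1) //.
rewrite big_mkord; apply: eq_bigl => q.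
rewrite next_outP // ?(ltn_ord q) //; last exact: (ltn_ord q).
case: q => q qk /=; rewrite andbC -andbA ltnS; congr (_ && _).
apply: eq_in_all => e; rewrite mem_index_iota => /andP[qe er].
rewrite !inE; have -> // : a +' e != a +' r.+1.
by apply/eqP => /iter_ordS_inj; lia.
Qed.

(** The fibres of [next_out T] over the complement of T partition the circle. *)
Lemma sum_gap_weight lam T : T \proper [set: 'I_k.+1] ->
  \sum_(i | i \notin T) gap_weight lam T i = \sum_j lam j.
Proof.
move=> /properP[_ [a _ aT]].
rewrite [RHS](partition_big (next_out T) (fun i => i \notin T)) //.
by move=> j _; have [d [_ -> _ ]] := next_out_spec j aT.
Qed.

(** The point where the circle is cut; the default [ord0] occurs only for the full set. *)
Definition out S := odflt ord0 [pick a | a \notin S].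

Lemma outP S : S \proper [set: 'I_k.+1] -> out S \notin S.
Proof.
by rewrite /out; case: pickP => // h /properP[_ [a _]]; rewrite h.
Qed.

Lemma drop_cword a r S : (0 < r <= k)%N -> a +' r \in S ->
  drop (index (a +' r) (cword a S)).+1 (cword a S) = [seq j <- desc a r.-1 | j \in S].
Proof.
case: r => // r rk iS; have [t e] := desc_split a rk.
have /andP[] := @decr_desc _ a k (leqnn k); rewrite e cat_uniq => /and3P[_ ht _] _.
have nt : a +' r.+1 \notin t.
  by apply: contraNN ht => h; apply/hasP; exists (a +' r.+1); rewrite //= mem_head.
rewrite /cword e filter_cat /= iS index_cat mem_filter (negPf nt) andbF /= eqxx.
by rewrite addn0 drop_cat ltnNge leqnSn /= subSnn /= drop0.
Qed.

(** Against the diagonal entry 2, i has two neighbours with entry -1, or one with entry -2 when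
    [k = 1]. So the sum of the simple coroots is central. *)
Lemma sum_cartan i : (0 < k)%N -> \sum_j cartan j i = 0.
Proof.
move=> k0; have inj : injective (fun q : 'I_k.+1 => i +' q).
  by move=> p q /iter_ordS_inj e; apply/val_inj/e; rewrite -ltnS.
rewrite (reindex_inj inj) /= -(big_mkord xpredT (fun q => cartan (i +' q) i)).
rewrite big_ltn //= {1}/cartan eqxx.
have adjE q : (q <= k)%N -> adjacent (i +' q) i = (q == 1%N) || (q == k).
  move=> qk; rewrite /adjacent -[ordS i]/(i +' 1) -[i in X in _ || X]/(i +' 0).
  rewrite -iterS !iter_ordS_eq.
  rewrite mod0n (modn_small (_ : q < k.+1)%N) // (modn_small (_ : 1 < k.+1)%N) //.
  congr (_ || _); have [->|qk'] := eqVneq q k; first by rewrite modnn.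
  by rewrite modn_small; lia.
have neE q : (0 < q <= k)%N -> (i +' q == i) = false.
  by move=> qk; apply/eqP => /(@iter_ordS_inj _ i q 0); lia.
have [k1|k1] := ltnP 1 k; last first.
  have {}k1 : k = 1%N by lia.
  rewrite big_ltn ?big_geq ?addr0 ?ltnS ?k1 // cartan_k1 ?addrN //.
  by rewrite (neE 1%N) // k1.
rewrite big_ltn // big_nat_recr //=.
rewrite big_nat_cond big1 => [|q /andP[/andP[q2 qk] _]]; last first.
  rewrite cartan_nadj ?neE //; last by lia.
  by rewrite adjE; lia.
have cE q : (q <= k)%N -> (q == 1%N) || (q == k) -> cartan (i +' q) i = - 1.
  by move=> qk h; apply: cartan_braided; rewrite /braided adjE // h k1.
by rewrite (cE 1%N) // (cE k) ?eqxx ?orbT.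
Qed.

Lemma sum_wact_level s lam : (0 < k)%N -> \sum_j wact s lam j = \sum_j lam j.
Proof.
move=> k0; elim: s => //= i s <-.
under eq_bigr => j _ do rewrite ffunE.
by rewrite sumrB -mulr_sumr sum_cartan // mulr0 subr0.
Qed.

End Coefficients.

(** * The down operator in an algebra satisfying the nilCoxeter relations *)

(* The nilCoxeter algebra enters through the properties stated as hypotheses; over
   [nilcox k] itself, rewriting would unfold the quotient construction. *)
Section AbstractAlgebra.
Variables (k : nat) (A : algType rat) (u : 'I_k.+1 -> A).
Hypothesis k_gt0 : (0 < k)%N.
Hypotheses (u_sq : forall i, u i * u i = 0)
  (u_comm : forall i j, ~~ adjacent i j -> u i * u j = u j * u i)
  (u_braid : forall i j, braided i j -> u i * u j * u i = u j * u i * u j).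
Implicit Types (s t : seq 'I_k.+1) (i j a : 'I_k.+1) (S T : {set 'I_k.+1}).
Implicit Types lam : {ffun 'I_k.+1 -> rat}.

Lemma uprod_decr_on S s t : decr_on S s -> decr_on S t -> uprod u s = uprod u t.
Proof.
move=> [ds sS] [dt tS]; have st : s =i t by move=> x; rewrite sS tS.
apply: (uprod_reduced u_comm u_braid); last exact: decr_unique.
- by case/andP: ds => /uniq_reduced.
- by case/andP: dt => /uniq_reduced.
Qed.

Lemma dprod_uniq lam s : uniq s -> dprod u lam s = \sum_(i in s)
  wact (drop (index i s).+1 s) lam i *: uprod u (rem i s).
Proof.
move=> us; rewrite dprodE -big_uniq // (big_nth ord0) big_mkord.
by apply: eq_bigr => n _; rewrite remE !index_uniq.
Qed.

(** For proper S any other decreasing word on S gives the same product, by [uprod_decr_on]. *)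
Definition uset S := uprod u (cword (out S) S).

Lemma dprod_cword lam S : S \proper [set: 'I_k.+1] ->
  dprod u lam (cword (out S) S) =
  \sum_(i in S) gap_weight lam (S :\ i) i *: uset (S :\ i).
Proof.
move=> pS; have aS := outP pS; set a := out S in aS *.
have [/andP[us ps] sS] := cword_decr_on aS.
rewrite dprod_uniq //; apply: eq_big => // i; rewrite sS => iS.
have [r rk e] := ex_iter_ordS a i.
have r0 : (0 < r <= k)%N.
  rewrite rk andbT lt0n; apply: contraNneq aS => r0.
  by rewrite r0 /= in e; rewrite -e.
rewrite e in iS *; rewrite drop_cword // gap_weightE //; congr (_ *: _).
(* The remaining word is decreasing on the smaller set, though cut at a rather than at the point
   chosen for that set. *)
apply: (@uprod_decr_on (S :\ iter r (@ordS _) a)); last first.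
  apply/cword_decr_on/outP; apply: sub_proper_trans pS; exact: finset.subD1set.
split; last by move=> x; rewrite mem_rem_uniq // !inE sS.
by rewrite rem_filter // /decr filter_uniq //= pairwise_filter.
Qed.

Definition hsum m : A :=
  \sum_(S : {set 'I_k.+1} | (S \proper [set: 'I_k.+1]) && (#|S| == m)) uset S.

Lemma proper_card m S : (m <= k)%N -> #|S| = m -> S \proper [set: 'I_k.+1].
Proof.
move=> mk Sm; rewrite properEcard finset.subsetT cardsT card_ord Sm ltnS mk //.
Qed.

(** Exchanging the sums groups the deletions by the set T that is left; the gap weights of T over
    its complement add up to the level. The bound [m <= k] makes every S of size m proper. *)
Lemma dprod_hsum lam m : (0 < m <= k)%N ->
  \sum_(S : {set 'I_k.+1} | (S \proper [set: 'I_k.+1]) && (#|S| == m))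
     dprod u lam (cword (out S) S) = (\sum_j lam j) *: hsum (m - 1)%N.
Proof.
move=> /andP[m0 mk].
transitivity (\sum_(S : {set 'I_k.+1} | #|S| == m) \sum_(i in S)
    gap_weight lam (S :\ i) i *: uset (S :\ i)).
  apply: eq_big => [S|S /andP[pS _]]; last exact: dprod_cword.
  by apply: andb_idl => /eqP /(proper_card mk).
rewrite (exchange_big_dep xpredT) //=.
transitivity (\sum_i \sum_(T : {set 'I_k.+1} | (#|T| == (m - 1)%N) && (i \notin T))
    gap_weight lam T i *: uset T).
  apply: eq_bigr => i _.
  (* Substitute for S the set T with i added; the round-trip condition says that i is not in T. *)
  rewrite (reindex_onto (fun T => i |: T) (fun S => S :\ i)) /=; last first.
    by move=> S /andP[_ iS]; rewrite finset.setD1K.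
  have cE T : (#|i |: T| == m) && (i \in i |: T) && ((i |: T) :\ i == T) =
      (#|T| == (m - 1)%N) && (i \notin T).
    rewrite finset.setU11 andbT; have [iT|iT] := boolP (i \in T).
      rewrite andbF; apply/negP => /andP[_ /eqP e].
      by move: iT; rewrite -e !inE eqxx.
    rewrite finset.setU1K // eqxx finset.cardsU1 iT !andbT add1n.
    by rewrite -{1}(prednK m0) eqSS subn1.
  apply: eq_big => // T; rewrite cE => /andP[_ iT].
  by rewrite finset.setU1K.
rewrite (exchange_big_dep (fun T : {set 'I_k.+1} => #|T| == (m - 1)%N)) //=; last first.
  by move=> i T _ /andP[].
rewrite scaler_sumr; apply: eq_big => [T|T cT].
  by rewrite andb_idl // => /eqP /proper_card -> //; lia.
rewrite -(sum_gap_weight lam (T := T)); last by apply: proper_card (eqP cT); lia.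
by rewrite scaler_suml; apply: eq_bigl => i; rewrite cT.
Qed.

Variables (R : root_datum k) (Lambda : 'Hom(cartan_space R, rat^o)).
Variables (uw : affsym k -> A) (D : {linear A -> A}).
Hypotheses (uwE : forall s, reduced s -> uw (Wword s) = uprod u s)
  (DE : forall w, D (uw w) = \sum_(v \in [set v | bruhat_cover v w])
     pairing (cover_coroot R v w) Lambda *: uw v)
  (span : forall x : A, exists r : seq (rat * seq 'I_k.+1),
     x = \sum_(p <- r) p.1 *: uprod u p.2).

(** The sum over covers is the sum over deletions of [dprodE], in which nonreduced deletions
    contribute 0. *)
Lemma down_reduced s : reduced s -> D (uprod u s) = dprod u (weight Lambda) s.
Proof.
move=> rs; rewrite -uwE // DE sum_covers // dprodE big_mkcond /=.
apply: eq_bigr => n _; case: ifPn => [rd|nrd]; first by rewrite uwE.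
by rewrite (uprod_nonreduced u_sq u_comm u_braid nrd) scaler0.
Qed.

Lemma down_uprod s : D (uprod u s) = dprod u (weight Lambda) s.
Proof.
have [rs|ns] := boolP (reduced s); first exact: down_reduced.
rewrite (uprod_nonreduced u_sq u_comm u_braid ns) linear0.
rewrite (dprod_nonreduced u_sq u_comm u_braid) // => p q rp rq pq.
by rewrite -!down_reduced // (uprod_reduced u_comm u_braid rp rq pq).
Qed.

Lemma hsum_uw m : \sum_(S : {set 'I_k.+1} |
    (S \proper [set: 'I_k.+1]) && (#|S| == m)) uw (wS S) = hsum m.
Proof.
apply: eq_bigr => S /andP[/outP/cword_decr_on d _].
rewrite (wSE k_gt0 d) uwE //; by case: d => /andP[/uniq_reduced].
Qed.

(** In D(u_S u_s) the factor u_S is differentiated along the weight moved by s; after summation over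
    S only the level of that weight matters, and s preserves it. *)
Lemma down_hsum_mul m x : (0 < m <= k)%N ->
  D (hsum m * x) =
  (\sum_j weight Lambda j) *: hsum (m - 1)%N * x + hsum m * D x.
Proof.
move=> mk.
have : forall s, D (hsum m * uprod u s) =
    (\sum_j weight Lambda j) *: hsum (m - 1)%N * uprod u s + hsum m * D (uprod u s).
  move=> s; rewrite -(sum_wact_level s _ k_gt0) -dprod_hsum // !mulr_suml.
  rewrite linear_sum -big_split /=; apply: eq_bigr => S _.
  by rewrite -uprod_cat !down_uprod dprod_cat.
(* Both sides are linear in x, so products of generators suffice. *)
move: (hsum m) (_ *: _) => H L W; have [r ->] := span x.
rewrite !mulr_sumr !linear_sum mulr_sumr -big_split /=; apply: eq_bigr => -[c s] _ /=.
by rewrite -!scalerAr !linearZ /= -scalerAr -scalerDr W.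
Qed.

End AbstractAlgebra.


(** * Transfer to the nilCoxeter algebra *)

Section NilCoxeterAlgebra.
Variable k : nat.
Implicit Types (i j : 'I_k.+1) (s : seq 'I_k.+1).

Lemma ugenE i : ugen i = nclass (@fgen k rat i).
Proof. by rewrite /ugen -lock. Qed.

Lemma nclass_eq (x y : {malg rat[{fmonom 'I_k.+1}]}) :
  nil_relator (@fgen k rat) (x - y) -> nclass x = nclass y.
Proof.
move=> xr; apply/nclassP.
by have := IdealD 1 1 xr (Ideal0 _); rewrite mul1r mulr1 addr0.
Qed.

Lemma ugen_sq i : ugen i * ugen i = 0.
Proof.
rewrite ugenE nclassM; apply: nclass_eq; rewrite subr0; exact: NilSquare.
Qed.

Lemma ugenM i j : ugen i * ugen j = nclass (@fgen k rat i * @fgen k rat j).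
Proof. exact: etrans (congr2 *%R (ugenE i) (ugenE j)) (nclassM _ _). Qed.

Lemma ugenMM i j l : ugen i * ugen j * ugen l =
  nclass (@fgen k rat i * @fgen k rat j * @fgen k rat l).
Proof. exact: etrans (congr2 *%R (ugenM i j) (ugenE l)) (nclassM _ _). Qed.

Lemma ugen_comm i j : ~~ adjacent i j -> ugen i * ugen j = ugen j * ugen i.
Proof.
move=> ij; apply: etrans (ugenM i j) (etrans _ (esym (ugenM j i))).
exact: nclass_eq (NilComm _ ij).
Qed.

Lemma ugen_braid i j : braided i j ->
  ugen i * ugen j * ugen i = ugen j * ugen i * ugen j.
Proof.
move=> ij; apply: etrans (ugenMM i j i) (etrans _ (esym (ugenMM j i j))).
exact: nclass_eq (NilBraid _ ij).
Qed.

Lemma uW_reduced s : reduced s -> uW (Wword s) = uprod (@ugen k) s.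
Proof.
have /andP[/eqP e /eqP sz] := redwordP (Wword s).
by move=> rs; apply: (uprod_reduced ugen_comm ugen_braid) => //; rewrite /reduced sz e.
Qed.

Lemma nilcox_span (x : nilcox k) : exists r : seq (rat * seq 'I_k.+1),
  x = \sum_(p <- r) p.1 *: uprod (@ugen k) p.2.
Proof.
rewrite -(nclass_repr x); move: (repr x) => y.
exists [seq (mcoeff m y, m : seq 'I_k.+1) | m <- enum_fset (msupp y)].
rewrite big_map {1}(malgEZ y) linear_sum; apply: eq_bigr => -[m] _.
exact: etrans (linearZ _ _) (congr1 _ (esym (uword_nclass m))).
Qed.

Variables (R : root_datum k) (Lambda : 'Hom(cartan_space R, rat^o)).

Lemma down_hh_mul m (x : nilcox k) : (0 < m <= k)%N ->
  fundamental_weight Lambda ->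
  down Lambda (hh k m * x) = hh k (m - 1) * x + hh k m * down Lambda x.
Proof.
move=> mk [j Lj]; have k0 : (0 < k)%N by lia.
have hE n : hh k n = hsum (@ugen k) n.
  apply: etrans (hsum_uw k0 uW_reduced n); apply: eq_bigl => S; congr andb.
  (* The two sums express properness through different full sets, a classical one and a finite
     one. *)
  by apply: eq_proper_r => i; rewrite finset.in_setT; apply: mem_set.
have := down_hsum_mul k0 ugen_sq ugen_comm ugen_braid uW_reduced
  (down_uW Lambda) nilcox_span x mk.
(* A fundamental weight has level 1. *)
have -> : \sum_i weight Lambda i = 1.
  under eq_bigr => i _ do rewrite ffunE Lj.
  by rewrite (bigD1 j) //= eqxx big1 ?addr0 // => i /negPf ->.
by rewrite scale1r -!hE.
Qed.

(** The empty word has no letter to delete. *)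
Lemma down1 : down Lambda 1 = 0.
Proof.
exact: etrans (congr1 (down Lambda) (esym (uprod_nil (@ugen k))))
  (down_uprod ugen_sq ugen_comm ugen_braid uW_reduced (down_uW Lambda) [::]).
Qed.

End NilCoxeterAlgebra.

Theorem theorem3p8 (k : nat) (k_gt0 : (0 < k)%N) (R : root_datum k)
    (Lambda : 'Hom(cartan_space R, rat^o))
    (Lambda_fund : fundamental_weight Lambda) :
  (forall (w : affsym k) (i : nat), (1 <= i <= k)%N ->
     down Lambda (hh k i * uW w) =
     hh k (i - 1) * uW w + hh k i * down Lambda (uW w)) /\
  (forall i : nat, (1 <= i <= k)%N -> down Lambda (hh k i) = hh k (i - 1)) /\
  (forall i : nat, (1 <= i <= k)%N ->
     (down Lambda \o U_op i) \- (U_op i \o down Lambda) =1 U_op (i - 1)).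
Proof.
split; first by move=> w i ik; apply: down_hh_mul.
split=> [i ik|i ik x] /=.
  have := down_hh_mul 1 ik Lambda_fund.
  by rewrite down1 !mulr1 mulr0 addr0.
have e := down_hh_mul x ik Lambda_fund.
exact: etrans (congr1 (fun y => y - _) e) (addrK _ _).
Qed.
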